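(* Let $1\le p<+\infty$. There exist positive constants $R_p$ and $\tilde R_p$ (depending only on $p$) such that for every $f\in L^p[0,\pi]$ and every $n\in\mathbb{N}$, $$\|\mathcal{GK}_n(f)-f\|_p\le R_p\,K_p(f,\tilde R_p m_n),$$ where $$m_n=\begin{cases}\dfrac{1+\log n}{n}, & p=1,\\[6pt] \dfrac1n+\dfrac{1}{n^{1/p}}, & 1<p<+\infty.\end{cases}$$
   Context: For $n\in\mathbb{N}$ and $k=1,\dots,n$ let $\theta_k^{(n)}=\frac{(2k-1)\pi}{2n}$ and, for real $\theta$, let $$P_k(\theta)=(-1)^{k+1}\frac{\cos(n\theta)\sin\theta_k^{(n)}}{n(\cos\theta-\cos\theta_k^{(n)})}$$ (the dependence on $n$ is suppressed; $P_k$ is extended by continuity at the removable singularities, so it is a polynomial in $\cos\theta$, namely the fundamental Lagrange polynomial at the Chebyshev nodes $\cos\theta_k^{(n)}$ evaluated at $\cos\theta$). The Grünwald–Kantorovich operators are defined for integrable $f$ on $[0,\pi]$ and $\theta\in[0,\pi]$ by $$\mathcal{GK}_n(f)(\theta)=\frac{n}{\pi}\sum_{k=1}^n\left(\int_{\theta_k^{(n)}}^{\theta_k^{(n)}+\frac{\pi}{2n}}f(t)\,dt\right)\left\{P_k\left(\theta+\frac{\pi}{2n}\right)+P_k\left(\theta-\frac{\pi}{2n}\right)\right\}.$$ For $1\le p<+\infty$, $f\in L^p[0,\pi]$ and $\delta>0$, the $K$-functional is $$K_p(f,\delta)=\inf_{g\in C^1[0,\pi]}\left\{\|f-g\|_p+\delta\|g'\|_\infty\right\},$$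 where $C^1[0,\pi]$ is the space of continuously differentiable functions on $[0,\pi]$, $\|\cdot\|_p$ is the $L^p[0,\pi]$ norm and $\|\cdot\|_\infty$ the sup-norm on $[0,\pi]$. *)

(* Defs.v *)
From HB Require Import structures.
From mathcomp Require Import all_boot all_order all_algebra.
From mathcomp Require Import all_classical all_reals all_analysis.

Set Implicit Arguments.
Unset Strict Implicit.
Unset Printing Implicit Defensive.

Import Order.TTheory GRing.Theory Num.Theory.
Import numFieldNormedType.Exports.

Local Open Scope classical_set_scope.
Local Open Scope ring_scope.

Section GrunwaldKantorovich.
Context {R : realType}.
Implicit Types (f g : R -> R) (n k : nat) (p x d t : R).

(* Functions on [0, pi] are represented by total functions R -> R of which only
   the values on this set matter. *)
Definition Ipi : set R := `[0, pi].

Definition theta_node n k : R := (2 * k%:R - 1) * pi / (2 * n%:R).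

Definition fund_quotient n k t : R :=
  (-1) ^+ k.+1 * (cos (n%:R * t) * sin (theta_node n k)
                  / (n%:R * (cos t - cos (theta_node n k)))).

(* [fund_quotient n k] extended by continuity to the zeros of its
   denominator. *)
Definition fund_poly n k t : R :=
  if cos t == cos (theta_node n k)
  then lim (fund_quotient n k @ t^')
  else fund_quotient n k t.

Definition GK n f t : R :=
  n%:R / pi *
  \sum_(1 <= k < n.+1)
    (\int[lebesgue_measure]_(u in
        `[theta_node n k, theta_node n k + pi / (2 * n%:R)]) f u) *
    (fund_poly n k (t + pi / (2 * n%:R)) + fund_poly n k (t - pi / (2 * n%:R))).

(* [f \_ Ipi] is [f] extended by 0 outside of [0, pi], so that the library's
   norms and spaces over the whole line give those over [0, pi]. *)
Definition in_LpI p f : Prop := f \_ Ipi \in Lfun lebesgue_measure p%:E.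

Definition normLpI p f : \bar R :=
  'N[lebesgue_measure]_(p%:E)[EFin \o (f \_ Ipi)]%E.

Definition sup_normI f : \bar R := ereal_sup [set `|f x|%:E | x in Ipi].

(* Derivatives are relative to [0, pi], hence one-sided at 0 and at pi. *)
Definition diff_quotient g x : R -> R := fun y => (g y - g x) / (y - x).

Definition derivableI g x : Prop :=
  cvg (diff_quotient g x @ within Ipi x^').

Definition deriveI g x : R := lim (diff_quotient g x @ within Ipi x^').

Definition C1I : set (R -> R) :=
  [set g | (forall x, Ipi x -> derivableI g x) /\
           {within Ipi, continuous (deriveI g)}].

Definition Kfunctional p f d : \bar R :=
  ereal_inf [set normLpI p (f \- g)%R + d%:E * sup_normI (deriveI g)
            | g in C1I]%E.

Definition m_rate p n : R :=
  if p == 1 then (1 + ln n%:R) / n%:R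
  else n%:R^-1 + (n%:R `^ p^-1)^-1.

End GrunwaldKantorovich.

(* Main.v *)
(* Write h = pi/2n and Q_k(t) = P_(k+1)(t + h) + P_(k+1)(t - h) for 0 <= k < n.
   By the Christoffel-Darboux identity P_(k+1) is a cosine polynomial, so the
   Q_k are continuous and sum to 2; hence GK_n reproduces constants.  The node terms
   of Q_k combine to
     2 sin(x+a) sin(x+b) sin(x-a) sin(x-b) Q_k(t)
       = -+ sin(2x) sin(a+b) sin(h) sin(nt) / n,
   with x = t/2, a = kh, b = (k+1)h, which gives the decay
   |Q_k(t)| <= 48 / (1 + |j - k|)^2 for t in [2jh, 2(j+1)h].  Since this
   matrix has bounded row and column sums, GK_n is bounded on L^p uniformly
   in n (Schur's test).  For a Lipschitz g with constant L the same decay and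
   the harmonic sum give |GK_n g - g| <= C L (1 + log n) / n pointwise, and
   (1 + log n) / n is at most a constant times m_n.  Splitting f = (f - g) + g
   and taking the infimum over g yields the theorem. *)

Require Import Defs.
From HB Require Import structures.
From mathcomp Require Import all_boot all_order all_algebra.
From mathcomp Require Import all_classical all_reals all_analysis.
From mathcomp Require Import measurable_realfun.
From mathcomp Require Import zify ring lra.
Import Order.TTheory GRing.Theory Num.Theory.
Import numFieldNormedType.Exports.
Local Open Scope classical_set_scope.
Local Open Scope ring_scope.

(** * Christoffel-Darboux kernel at the Chebyshev nodes *)

(** The Christoffel-Darboux kernel of the Chebyshev polynomials T_m(cos t) = cos(mt) of degree m <
    n. *)
Definition cheb_kernel {R : realType} (n : nat) (s t : R) : R :=
  1 + 2 * \sum_(1 <= m < n) cos (m%:R * t) * cos (m%:R * s).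

(** The shift in the operator, written h below: the nodes are odd multiples of h, and nh = pi/2. *)
Definition mesh {R : realType} (n : nat) : R := pi / (2 * n%:R).

(** Induction on [n]: the addition formulas express all terms through the sines and cosines of ns,
    nt, s and t, and what remains is a polynomial identity modulo cos^2 + sin^2 = 1. *)
Lemma christoffel_darboux (R : realType) (n : nat) (s t : R) :
  (cos t - cos s) * cheb_kernel n.+1 s t =
  cos (n.+1%:R * t) * cos (n%:R * s) - cos (n%:R * t) * cos (n.+1%:R * s).
Proof.
rewrite /cheb_kernel; elim: n => [|n IHn].
  by rewrite big_geq// !mul1r !mul0r cos0 mulr0 addr0 !mulr1 mul1r.
rewrite big_nat_recr//= !mulrDr !addrA -[X in X + _]mulrDr IHn.
have cosS (m : nat) (x : R) :
    cos (m.+1%:R * x) = cos (m%:R * x) * cos x - sin (m%:R * x) * sin x.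
  by rewrite -cosD; congr cos; rewrite -natr1; ring.
have sinS (m : nat) (x : R) :
    sin (m.+1%:R * x) = sin (m%:R * x) * cos x + cos (m%:R * x) * sin x.
  by rewrite -sinD; congr sin; rewrite -natr1; ring.
rewrite !(cosS n.+1) !cosS !sinS.
have := cos2Dsin2 s; have := cos2Dsin2 t.
set a := cos s; set b := sin s; set c := cos t; set d := sin t.
move=> /(canRL (addrK _)) ea /(canRL (addrK _)) eb.
set x := cos (n%:R * t); set y := cos (n%:R * s).
set z := sin (n%:R * t); set w := sin (n%:R * s).
ring: ea eb.
Qed.

Lemma sinDnatpi (R : realType) (x : R) (k : nat) :
  sin (x + k%:R * pi) = (-1) ^+ k * sin x.
Proof. by rewrite mulr_natl (alternatingn (@sinDpi R)). Qed.

Lemma cosDnatpi (R : realType) (x : R) (k : nat) :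
  cos (x + k%:R * pi) = (-1) ^+ k * cos x.
Proof. by rewrite mulr_natl (alternatingn (@cosDpi R)). Qed.

Lemma sinM2_cos (R : realType) (x y : R) :
  2 * sin x * cos y = sin (y + x) - sin (y - x).
Proof. by rewrite sinB sinD; ring. Qed.

Lemma mesh_gt0 (R : realType) (n : nat) : (0 < n)%N -> 0 < mesh n :> R.
Proof. by move=> n0; rewrite divr_gt0 ?pi_gt0 ?mulr_gt0 ?ltr0n. Qed.

Lemma theta_nodeE (R : realType) (n k : nat) :
  theta_node n k.+1 = (2 * k%:R + 1) * mesh n :> R.
Proof. by rewrite /theta_node /mesh -natr1 mulrA; congr (_ * _ * _); ring. Qed.

Lemma natM_mesh (R : realType) (n : nat) : (0 < n)%N ->
  n%:R * mesh n = pi / 2 :> R.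
Proof.
move=> n0; rewrite /mesh; field.
by rewrite pnatr_eq0 -lt0n.
Qed.

Lemma natM_theta_node (R : realType) (n k : nat) : (0 < n)%N ->
  n%:R * theta_node n k.+1 = k%:R * pi + pi / 2 :> R.
Proof.
move=> n0; rewrite theta_nodeE mulrCA natM_mesh//; lra.
Qed.

Lemma theta_node_itv (R : realType) (n k : nat) : (k < n)%N ->
  0 < (theta_node n k.+1 : R) < pi.
Proof.
move=> kn; have n0 : (0 < n)%N by case: n kn.
have h0 := @mesh_gt0 R n n0; have := @natM_mesh R n n0.
rewrite theta_nodeE => /(canRL (mulfK _)) hh; apply/andP; split.
  by rewrite mulr_gt0// ltr_wpDl// mulr_ge0// ler0n.
have -> : pi = (2 * n%:R) * mesh n :> R.
  by rewrite -mulrA natM_mesh//; lra.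
rewrite ltr_pM2r//.
have : k%:R + 1 <= n%:R :> R by rewrite natr1 ler_nat.
lra.
Qed.

Lemma sin_natM_theta_node (R : realType) (n k : nat) : (0 < n)%N ->
  sin (n%:R * theta_node n k.+1) = (-1) ^+ k :> R.
Proof.
by move=> n0; rewrite natM_theta_node// addrC sinDnatpi sin_pihalf mulr1.
Qed.

Lemma cos_natM_theta_node (R : realType) (n k : nat) : (0 < n)%N ->
  cos (n%:R * theta_node n k.+1) = 0 :> R.
Proof.
by move=> n0; rewrite natM_theta_node// addrC cosDnatpi cos_pihalf mulr0.
Qed.

Lemma cos_subE (R : realType) (x y : R) :
  cos x - cos y = - 2 * sin ((x + y) / 2) * sin ((x - y) / 2).
Proof.
have -> : x = (x + y) / 2 + (x - y) / 2 by lra.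
have {3}-> : y = (x + y) / 2 - (x - y) / 2 by lra.
set a := (x + y) / 2; set b := (x - y) / 2.
have -> : (a + b + y) / 2 = a by rewrite /a /b; lra.
have -> : (a + b - y) / 2 = b by rewrite /a /b; lra.
by rewrite cosD cosB; ring.
Qed.

(** In cos s - cos t = -2 sin((s+t)/2) sin((s-t)/2) the first sine tends to sin t, which is nonzero,
    and the second is nonzero for 0 < |s - t| < 1. *)
Lemma near_cos_neq (R : realType) (t : R) : sin t != 0 ->
  \forall s \near t^', cos s != cos t.
Proof.
move=> st.
have c : (fun s : R => sin ((s + t) / 2)) @ t^' --> sin t.
  apply: cvg_within_filter.
  have -> : sin t = sin ((t + t) / 2) by congr sin; lra.
  apply: continuous_cvg; first exact: continuous_sin.
  by apply: cvgMr_tmp; apply: cvgD; [exact: cvg_id|exact: cvg_cst].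
have c0 : \forall s \near t^', sin ((s + t) / 2) != 0.
  exact: cvgr_neq0 c st.
near=> s.
rewrite -subr_eq0 cos_subE; apply: mulf_neq0.
  by apply: mulf_neq0; [apply/eqP; lra|near: s].
have sneqt : s - t != 0 by rewrite subr_eq0; near: s; exact: nbhs_dnbhs_neq.
have dst : `|s - t| < 1.
  rewrite distrC; near: s; apply: nbhs_dnbhs; exact: (@cvgr_dist_lt _ _ _ (nbhs t) _ id t) cvg_id _ ltr01.
have pi2 := @pi_ge2 R.
have [st0|st0] := ltrP 0 (s - t).
  rewrite gt_eqF// sin_gt0_pi//; rewrite gtr0_norm// in dst.
  by apply/andP; split; lra.
have {}st0 : s - t < 0 by rewrite lt_neqAle sneqt.
rewrite ltr0_norm// in dst.
rewrite lt_eqF// -oppr_gt0 -sinN sin_gt0_pi//.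
by apply/andP; split; lra.
Unshelve. all: by end_near. Qed.

Lemma continuous_sumr {R : realType} (T : topologicalType) (I : Type)
    (s : seq I) (f : I -> T -> R) :
  (forall i, continuous (f i)) -> continuous (fun t => \sum_(i <- s) f i t).
Proof.
move=> cf; elim: s => [|i s ih] t.
  by under eq_fun do rewrite big_nil; exact: cvg_cst.
by under eq_fun do rewrite big_cons; apply: cvgD; [exact: cf|exact: ih].
Qed.

Lemma continuous_cosM (R : realType) (a : R) : continuous (fun t : R => cos (a * t)).
Proof.
move=> t; apply: (@continuous_cvg _ _ _ _ _ (fun t => a * t) cos); first exact: continuous_cos.
by apply: cvgMl_tmp; exact: cvg_id.
Qed.

Lemma continuous_cheb_kernel (R : realType) (n : nat) (s : R) :
  continuous (cheb_kernel n s).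
Proof.
move=> t; apply: cvgD; first exact: cvg_cst.
apply: cvgMl_tmp; apply: continuous_sumr => m x.
by apply: cvgMr_tmp; exact: continuous_cosM.
Qed.

(** At a node s one has cos(ns) = 0, which kills one term of [christoffel_darboux], and cos((n-1)s)
    = sin(ns) sin s = (-1)^k sin s. *)
Lemma cheb_kernel_node (R : realType) (n k : nat) (t : R) : (0 < n)%N ->
  (cos t - cos (theta_node n k.+1)) * cheb_kernel n (theta_node n k.+1) t =
  (-1) ^+ k * cos (n%:R * t) * sin (theta_node n k.+1).
Proof.
case: n => // n _; set s := theta_node n.+1 k.+1.
rewrite christoffel_darboux cos_natM_theta_node// mulr0 subr0.
have -> : n%:R * s = n.+1%:R * s - s by rewrite -natr1; ring.
by rewrite cosB cos_natM_theta_node// sin_natM_theta_node//; ring.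
Qed.

Lemma fund_quotientE (R : realType) (n k : nat) (t : R) : (0 < n)%N ->
  cos t != cos (theta_node n k.+1) ->
  fund_quotient n k.+1 t = cheb_kernel n (theta_node n k.+1) t / n%:R.
Proof.
move=> n0 tk; have n0' : n%:R != 0 :> R by rewrite pnatr_eq0 -lt0n.
have tk0 : cos t - cos (theta_node n k.+1) != 0 by rewrite subr_eq0.
apply: (mulfI tk0); rewrite [RHS]mulrA cheb_kernel_node//.
(* With nodes counted from 0 the sign is (-1)^(k+2) = (-1)^k. *)
rewrite /fund_quotient 2!exprS mulrA mulN1r opprK mul1r; field.
by rewrite tk0 n0'.
Qed.

(** At a zero of the denominator cos t equals the cosine of a node in (0, pi), so sin t is nonzero
    and the zero is isolated. Near it the quotient coincides with the continuous kernel, whose value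
    is therefore the limit. *)
Lemma fund_polyE (R : realType) (n k : nat) (t : R) : (k < n)%N ->
  fund_poly n k.+1 t = cheb_kernel n (theta_node n k.+1) t / n%:R.
Proof.
move=> kn; have n0 : (0 < n)%N by case: n kn.
rewrite /fund_poly; case: eqP => [tk|/eqP]; last exact: fund_quotientE.
have st : sin t != 0.
  have /sin_gt0_pi : 0 < (theta_node n k.+1 : R) < pi by exact: theta_node_itv.
  by apply: contraTneq => /eqP; rewrite -sqrf_eq0 sin2cos2 tk -sin2cos2
    sqrf_eq0 => /eqP ->; rewrite ltxx.
pose K (s : R) : R := cheb_kernel n (theta_node n k.+1) s / n%:R.
have cK : K s @[s --> t^'] --> K t.
  by apply: cvgMr_tmp; apply: cvg_within_filter; exact: continuous_cheb_kernel.
have cq : fund_quotient n k.+1 s @[s --> t^'] --> K t.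
  apply: cvg_trans cK; apply: near_eq_cvg; near=> s.
  rewrite fund_quotientE// -tk.
  by near: s; exact: near_cos_neq.
exact: cvg_lim cq.
Unshelve. all: by end_near. Qed.

(** * The kernel of the operator *)

(** Multiplied by 2 sin(mh), which is nonzero because 0 < mh < pi/2, the sum telescopes to sin(2nmh)
    = sin(m pi) = 0. *)
Lemma sum_cos_theta_node (R : realType) (n m : nat) : (0 < m < n)%N ->
  \sum_(k < n) cos (m%:R * theta_node n k.+1) = 0 :> R.
Proof.
move=> /andP[m0 mn]; have n0 : (0 < n)%N by exact: leq_trans mn.
have h0 := @mesh_gt0 R n n0; have hn := @natM_mesh R n n0.
have s0 : 2 * sin (m%:R * mesh n) != 0 :> R.
  rewrite mulf_neq0 ?pnatr_eq0// gt_eqF// sin_gt0_pi// mulr_gt0 ?ltr0n//=.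
  have : m%:R * mesh n < n%:R * mesh n :> R by rewrite ltr_pM2r// ltr_nat.
  have := @pi_gt0 R; lra.
apply: (mulfI s0); rewrite mulr0 mulr_sumr.
pose u (k : nat) : R := sin ((2 * k%:R) * (m%:R * mesh n)).
rewrite (eq_bigr (fun k : 'I_n => u k.+1 - u k)); last first.
  move=> k _; rewrite theta_nodeE sinM2_cos /u; congr (sin _ - sin _).
    by rewrite -natr1; ring.
  by ring.
rewrite -(big_mkord predT (fun k => u k.+1 - u k)) telescope_sumr//.
rewrite /u mulr0 mul0r sin0 subr0.
have -> : 2 * n%:R * (m%:R * mesh n) = 0 + m%:R * pi :> R.
  rewrite (_ : _ * _ = 2 * m%:R * (n%:R * mesh n)); last by ring.
  by rewrite hn; lra.
by rewrite sinDnatpi sin0 mulr0.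
Qed.

(** Only the constant term of the kernel survives summation over the nodes. After division by n this
    is the partition of unity of the Lagrange basis. *)
Lemma sum_cheb_kernel (R : realType) (n : nat) (t : R) : (0 < n)%N ->
  \sum_(k < n) cheb_kernel n (theta_node n k.+1) t = n%:R.
Proof.
move=> n0; rewrite big_split/= sumr_const card_ord -mulr_sumr exchange_big/=.
rewrite big_nat_cond big1 ?mulr0 ?addr0// => m.
by rewrite andbT => mn; rewrite -mulr_sumr sum_cos_theta_node ?mulr0.
Qed.

(* Nodes are indexed from 0 here: [gk_kernel n k] belongs to [theta_node n k.+1]. *)
Definition gk_kernel {R : realType} (n k : nat) (t : R) : R :=
  fund_poly n k.+1 (t + mesh n) + fund_poly n k.+1 (t - mesh n).

Lemma sum_gk_kernel (R : realType) (n : nat) (t : R) : (0 < n)%N ->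
  \sum_(k < n) gk_kernel n k t = 2.
Proof.
move=> n0; rewrite big_split/=.
under eq_bigr do rewrite fund_polyE//.
under [X in _ + X]eq_bigr do rewrite fund_polyE//.
rewrite -!mulr_suml !sum_cheb_kernel// divff ?pnatr_eq0 -?lt0n//.
Qed.

Lemma continuous_gk_kernel (R : realType) (n k : nat) : (k < n)%N ->
  continuous (@gk_kernel R n k).
Proof.
move=> kn.
have cP (a : R) : continuous (fun t => fund_poly n k.+1 (t + a)).
  rewrite (_ : (fun t => _) =
    fun t => cheb_kernel n (theta_node n k.+1) (t + a) / n%:R); last first.
    by apply/funext => t; rewrite fund_polyE.
  move=> t; apply: cvgMr_tmp.
  apply: (@continuous_cvg _ _ _ _ _ (fun s => s + a) (cheb_kernel n _)).
    exact: continuous_cheb_kernel.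
  by apply: cvgD; [exact: cvg_id|exact: cvg_cst].
by move=> t; apply: cvgD; [exact: cP|exact: (cP (- mesh n))].
Qed.

(** The numerators cos(n(t + h)) = -sin(nt) and cos(n(t - h)) = sin(nt) are opposite, so over a
    common denominator only the difference cos(t + h) - cos(t - h) = -2 sin t sin h of the two
    denominators remains. This cancellation produces quadratic decay. The form without division also
    covers the zeros of the denominators. *)
Lemma gk_kernelM (R : realType) (n k : nat) (t : R) : (k < n)%N ->
  let x := t / 2 in let a := k%:R * mesh n in let b := k.+1%:R * mesh n in
  2 * (sin (x + a) * sin (x + b)) * (sin (x - a) * sin (x - b)) * gk_kernel n k t =
  - ((-1) ^+ k * (sin (2 * x) * sin (a + b)) * (sin (mesh n) * sin (n%:R * t)) / n%:R).
Proof.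
move=> kn x a b; have n0 : (0 < n)%N by case: n kn {a b}.
pose s : R := theta_node n k.+1.
have es : s = a + b by rewrite /s theta_nodeE /a /b -natr1; ring.
have n0' : n%:R != 0 :> R by rewrite pnatr_eq0 -lt0n.
have e1 : cos (t + mesh n) - cos s = - 2 * (sin (x + b) * sin (x - a)).
  rewrite cos_subE mulrA; congr (_ * sin _ * sin _).
    by rewrite es /x /a /b -natr1; lra.
  by rewrite es /x /a /b -natr1; lra.
have e2 : cos (t - mesh n) - cos s = - 2 * (sin (x + a) * sin (x - b)).
  rewrite cos_subE mulrA; congr (_ * sin _ * sin _).
    by rewrite es /x /a /b -natr1; lra.
  by rewrite es /x /a /b -natr1; lra.
have k1 := cheb_kernel_node R n k (t + mesh n) n0.
have k2 := cheb_kernel_node R n k (t - mesh n) n0.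
rewrite -/s e1 (mulrDr n%:R) natM_mesh// cosDpihalf in k1.
rewrite -/s e2 (mulrBr n%:R) natM_mesh// cosBpihalf in k2.
have e3 : cos (t + mesh n) - cos (t - mesh n) = - 2 * sin (2 * x) * sin (mesh n).
  by rewrite cos_subE; congr (_ * sin _ * sin _); rewrite /x; lra.
have e4 : - 2 * (sin (x + b) * sin (x - a)) - - 2 * (sin (x + a) * sin (x - b)) =
    - 2 * sin (2 * x) * sin (mesh n).
  by rewrite -e1 -e2 -e3; ring.
rewrite /gk_kernel !fund_polyE// -/s -es.
set K1 := cheb_kernel n s (t + mesh n) in k1 *.
set K2 := cheb_kernel n s (t - mesh n) in k2 *.
set S := sin s; set p := (-1) ^+ k; set N := sin (n%:R * t).
rewrite -/S -/p -/N in k1 k2.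
move: (sin (x + a)) (sin (x + b)) (sin (x - a)) (sin (x - b)) k1 k2 e4
  => u v w z k1 k2 e4.
transitivity ((- 1) * ((u * z) * (- 2 * (v * w) * K1) + (v * w) * (- 2 * (u * z) * K2)) / n%:R).
  by field.
rewrite k1 k2.
transitivity (- (p * N * S / n%:R) * ((- 2 * (v * w) - - 2 * (u * z)) / - 2)).
  by field.
by rewrite e4; field.
Qed.

(** * Elementary bounds for the sine *)

Lemma sin_MVT (R : realType) (x : R) : 0 <= x ->
  exists2 c : R, 0 <= c <= x & sin x = cos c * x.
Proof.
move=> x0; have [|c] := @MVT_segment R sin cos 0 x x0.
  by apply: continuous_subspaceT; exact: continuous_sin.
by rewrite in_itv/= sin0 !subr0 => cx e; exists c.
Qed.

Lemma sin_le_id (R : realType) (x : R) : 0 <= x -> sin x <= x.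
Proof.
move=> x0; have [c _ ->] := sin_MVT R x x0.
by rewrite ler_piMl// cos_le1.
Qed.

Lemma norm_sin_le (R : realType) (x : R) : `|sin x| <= `|x|.
Proof.
have h (y : R) : 0 <= y -> `|sin y| <= `|y|.
  move=> y0; rewrite (ger0_norm y0) ler_norml sin_le_id// andbT.
  have [c _ ->] := sin_MVT R y y0.
  by rewrite -mulN1r ler_wpM2r// cos_geN1.
have [x0|/ltW x0] := leP 0 x; first exact: h.
by rewrite -normrN -sinN -(normrN x) h// oppr_ge0.
Qed.

(** Write sin x = 2 sin(x/2) cos(x/2). By the mean value theorem sin(x/2) = cos(c) x/2 with cos c >=
    cos(x/2), and cos(x/2)^2 >= 1/2 because cos x >= 0. *)
Lemma sin_ge_half (R : realType) (x : R) : 0 <= x <= pi / 2 -> x / 2 <= sin x.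
Proof.
move=> /andP[x0 xpi].
have pi0 := @pi_gt0 R.
have x20 : 0 <= x / 2 by lra.
have [c /andP[c0 cx] sc] := sin_MVT R (x / 2) x20.
have cge0 : 0 <= cos x by apply: cos_ge0_pihalf; apply/andP; split; lra.
have c2 : 0 <= cos (x / 2) by apply: cos_ge0_pihalf; apply/andP; split; lra.
have cc : cos (x / 2) <= cos c.
  move: cx; rewrite le_eqVlt => /predU1P[->//|cx].
  by rewrite ltW// ltr_cos// in_itv/=; apply/andP; split; lra.
have e : x = x / 2 *+ 2 by rewrite mulr2n; lra.
rewrite {2}e sin_mulr2n sc.
move: cge0; rewrite {1}e cos_mulr2n => cge0.
have : cos (x / 2) * cos (x / 2) * (x / 2) <= cos (x / 2) * (cos c * (x / 2)).
  by rewrite [leRHS]mulrA; apply: ler_wpM2r => //; exact: ler_wpM2l.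
have half : 1 / 2 <= cos (x / 2) * cos (x / 2).
  by move: cge0; rewrite expr2; lra.
by have := ler_wpM2r x20 half; lra.
Qed.

Lemma norm_sin_ge_half (R : realType) (x : R) : `|x| <= pi / 2 ->
  `|x| / 2 <= `|sin x|.
Proof.
have h (y : R) : 0 <= y -> y <= pi / 2 -> y / 2 <= `|sin y|.
  by move=> y0 y1; rewrite (le_trans (sin_ge_half R y _)) ?y0// ler_norm.
have [x0|x0] := ger0P x; first exact: h.
by rewrite -(normrN (sin x)) -sinN; apply: h; lra.
Qed.

(* [sin 2x sin (a + b) = sin (x + a) sin (x + b) - sin (x - a) sin (x - b)],
   and each factor of the last product is dominated by the corresponding one
   of the first. *)
Lemma sin2M_sinD_le (R : realType) (x a b : R) :
  0 <= x <= pi / 2 -> 0 <= a <= pi / 2 -> 0 <= b <= pi / 2 ->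
  `|sin (2 * x) * sin (a + b)| <= 2 * (sin (x + a) * sin (x + b)).
Proof.
move=> xI aI bI.
have dom (c : R) : 0 <= c <= pi / 2 -> `|sin (x - c)| <= sin (x + c).
  have ge0 (y : R) : 0 <= y <= pi / 2 -> 0 <= sin y /\ 0 <= cos y.
    move=> /andP[y0 y1]; split.
      by apply: sin_ge0_pi; apply/andP; split; lra.
    by apply: cos_ge0_pihalf; apply/andP; split; lra.
  move=> /ge0[sc cc]; have [sx cx] := ge0 _ xI.
  rewrite ler_norml sinB sinD; apply/andP; split.
    by have := mulr_ge0 sx cc; lra.
  by have := mulr_ge0 cx sc; lra.
have -> : sin (2 * x) * sin (a + b) =
    sin (x + a) * sin (x + b) - sin (x - a) * sin (x - b).
  rewrite mulr_natl sin_mulr2n !sinB !sinD.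
  ring.
apply: le_trans (ler_normB _ _) _; rewrite !normrM.
have p1 := le_trans (normr_ge0 _) (dom _ aI).
have p2 := le_trans (normr_ge0 _) (dom _ bI).
have := ler_pM (normr_ge0 _) (normr_ge0 _) (dom _ aI) (dom _ bI).
rewrite (ger0_norm p1) (ger0_norm p2); lra.
Qed.

(** * Decay of the kernel away from its node *)

Lemma norm_sin_natM_le (R : realType) (n i : nat) (t : R) : (0 < n)%N ->
  `|sin (n%:R * t)| <= 2 * n%:R * `|t / 2 - i%:R * mesh n|.
Proof.
move=> n0; have hn := @natM_mesh R n n0.
(* Since sin(nt) vanishes at t = 2ih, it is bounded by n times the distance to that zero. *)
have -> : n%:R * t = 2 * n%:R * (t / 2 - i%:R * mesh n) + i%:R * pi.
  rewrite mulrBr (_ : _ * (i%:R * _) = 2 * i%:R * (n%:R * mesh n)); last by ring.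
  by rewrite hn; lra.
rewrite sinDnatpi normrM normrX normrN1 expr1n mul1r.
by rewrite (le_trans (norm_sin_le _ _))// normrM ger0_norm// mulr_ge0// ler0n.
Qed.

(** In [gk_kernelM] the positive factor 2 sin(x+a) sin(x+b) cancels against its bound from
    [sin2M_sinD_le]. The sines of x - a and x - b are at least half their arguments in absolute
    value, whence the constant 4. *)
Lemma gk_kernel_le (R : realType) (n k : nat) (t : R) : (k < n)%N ->
  0 < t < pi ->
  `|t / 2 - k%:R * mesh n| * `|t / 2 - k.+1%:R * mesh n| * `|gk_kernel n k t| <=
  4 * mesh n * `|sin (n%:R * t)| / n%:R.
Proof.
move=> kn /andP[t0 tpi]; have n0 : (0 < n)%N by case: n kn.
have h0 := @mesh_gt0 R n n0; have hn := @natM_mesh R n n0.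
have := @gk_kernelM R n k t kn; cbv zeta.
set x := t / 2; set a := k%:R * mesh n; set b := k.+1%:R * mesh n => eQ.
have xI : 0 < x < pi / 2 by apply/andP; split; rewrite /x; lra.
have a0 : 0 <= a by rewrite mulr_ge0 ?ler0n// ltW.
have ab : a < b by rewrite ltr_pM2r// ltr_nat.
have bpi : b <= pi / 2 by rewrite -hn ler_pM2r// ler_nat.
have [x0 xpi] := andP xI.
have pa : 0 < sin (x + a) by apply: sin_gt0_pi; apply/andP; split; lra.
have pb : 0 < sin (x + b) by apply: sin_gt0_pi; apply/andP; split; lra.
have P0 := mulr_gt0 pa pb.
have ua : `|x - a| / 2 <= `|sin (x - a)|.
  by apply: norm_sin_ge_half; rewrite ler_norml; apply/andP; split; lra.
have vb : `|x - b| / 2 <= `|sin (x - b)|.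
  by apply: norm_sin_ge_half; rewrite ler_norml; apply/andP; split; lra.
have sI : `|sin (2 * x) * sin (a + b)| <= 2 * (sin (x + a) * sin (x + b)).
  by apply: sin2M_sinD_le; apply/andP; split; lra.
have n0' : 0 < n%:R^-1 :> R by rewrite invr_gt0 ltr0n.
have eN := congr1 Num.norm eQ.
move: eN; rewrite normrN !normrM !normrX normrN1 expr1n mul1r.
rewrite normr_nat (gtr0_norm pa) (gtr0_norm pb) (gtr0_norm n0') -(normrM (sin (2 * x))).
move=> eN.
have shh : `|sin (mesh n)| <= mesh n :> R.
  by rewrite (le_trans (norm_sin_le _ _))// gtr0_norm.
set q := `|gk_kernel n k t| in eN *; set N := `|sin (n%:R * t)| in eN *.
have N0 : 0 <= N by exact: normr_ge0.
have q0 : 0 <= q by exact: normr_ge0.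
set P := sin (x + a) * sin (x + b) in P0 sI eN.
have l1 : `|sin (x - a)| * `|sin (x - b)| * q <= mesh n * N / n%:R.
  have P2 : 0 < 2 * P by lra.
  have hN := ler_wpM2r N0 shh.
  have A := ler_pM (normr_ge0 _) (mulr_ge0 (normr_ge0 _) N0) sI hN.
  have B := ler_wpM2r (ltW n0') A.
  by rewrite -(ler_pM2l P2); lra.
have l2 := ler_pM (divr_ge0 (normr_ge0 (x - a)) (ler0n R 2))
  (divr_ge0 (normr_ge0 (x - b)) (ler0n R 2)) ua vb.
have l3 := ler_wpM2r q0 l2.
lra.
Qed.

(** The decay profile for t in the j-th interval of length 2h and the k-th node. The constant 48
    comes from [gk_kernel_open]. *)
Definition gk_weight {R : realType} (j k : nat) : R :=
  48 / (1 + `|j%:R - k%:R|) ^+ 2.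

(** Let u, v be the distances of t/2 to kh and (k+1)h, and q the absolute value of the kernel.
    Bounding |sin(nt)| by 1, by 2nu or by 2nv in [gk_kernel_le] gives uvq <= 4h^2, vq <= 8h and uq
    <= 8h. The interval is open so that u and v are positive and can be cancelled. *)
Lemma gk_kernel_open (R : realType) (n j k : nat) (t : R) :
  (j < n)%N -> (k < n)%N ->
  2 * j%:R * mesh n < t < 2 * j.+1%:R * mesh n ->
  `|gk_kernel n k t| <= gk_weight j k.
Proof.
move=> jn kn /andP[tl tr]; have n0 : (0 < n)%N by exact: leq_trans jn.
have h0 := @mesh_gt0 R n n0; have hn := @natM_mesh R n n0.
have n0' : 0 < n%:R :> R by rewrite ltr0n.
have tI : 0 < t < pi.
  have j0 : 0 <= 2 * j%:R * mesh n :> R.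
    by apply: mulr_ge0 (ltW h0); exact: mulr_ge0.
  have : j.+1%:R * mesh n <= n%:R * mesh n :> R by rewrite ler_pM2r// ler_nat.
  by move=> ?; apply/andP; split; lra.
have := @gk_kernel_le R n k t kn tI.
have Na := @norm_sin_natM_le R n k t n0.
have Nb := @norm_sin_natM_le R n k.+1 t n0.
have N1 : `|sin (n%:R * t)| <= 1 by exact: sin_max.
set u := `|t / 2 - k%:R * mesh n| in Na *.
set v := `|t / 2 - k.+1%:R * mesh n| in Nb *.
set q := `|gk_kernel n k t|; set N := `|sin (n%:R * t)| in Na Nb N1 *.
have u0 : 0 <= u by exact: normr_ge0.
have v0 : 0 <= v by exact: normr_ge0.
have q0 : 0 <= q by exact: normr_ge0.
rewrite ler_pdivlMr// => uvN.
have m0 : 0 <= 4 * mesh n :> R by lra.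
have uvq1 : u * v * q <= 4 * mesh n ^+ 2.
  rewrite -(ler_pM2r n0').
  have := ler_wpM2l m0 N1.
  have : 4 * mesh n * 1 <= 4 * mesh n * (mesh n * n%:R) :> R.
    apply: ler_wpM2l => //; rewrite (mulrC (mesh n)) hn.
    by have := @pi_ge2 R; lra.
  rewrite expr2; lra.
have vq : u * (v * q) <= u * (8 * mesh n).
  rewrite -(ler_pM2r n0').
  have := ler_wpM2l m0 Na; lra.
have uq : v * (u * q) <= v * (8 * mesh n).
  rewrite -(ler_pM2r n0').
  have := ler_wpM2l m0 Nb; lra.
(* Off the diagonal w is the larger of u, v and z the smaller: w^2 = wz + hw yields q(2w)^2 <= 4 *
   4h^2 + 4 * 8h^2 = 48h^2. *)
have far (w z D : R) : 0 < z -> w = z + mesh n -> w * z * q <= 4 * mesh n ^+ 2 ->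
    z * (w * q) <= z * (8 * mesh n) -> 0 <= D <= 2 * w ->
    q * D ^+ 2 <= 48 * mesh n ^+ 2.
  move=> z0 ewz wzq; rewrite ler_pM2l// => wq /andP[D0 Dw].
  have eh : mesh n = w - z by rewrite ewz; ring.
  have w2 : q * (2 * w) ^+ 2 <= 48 * mesh n ^+ 2.
    have -> : q * (2 * w) ^+ 2 = 4 * (w * z * q) + 4 * (mesh n * (w * q)).
      by rewrite eh; ring.
    have := ler_wpM2l (ltW h0) wq.
    by rewrite !expr2 in wzq *; lra.
  apply: le_trans w2; apply: ler_wpM2l => //; apply: lerXn2r => //.
  by rewrite nnegrE (le_trans D0).
rewrite /gk_weight ler_pdivlMr; last by rewrite exprn_gt0// ltr_pwDl.
rewrite -(ler_pM2r (exprn_gt0 2 h0)) -mulrA -exprMn.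
have D0 : 0 <= (1 + `|j%:R - k%:R|) * mesh n :> R.
  by apply: mulr_ge0 (ltW h0); exact: addr_ge0.
have ev : k.+1%:R * mesh n = k%:R * mesh n + mesh n :> R by rewrite -natr1; ring.
have ej : 2 * j.+1%:R * mesh n = 2 * j%:R * mesh n + 2 * mesh n :> R.
  by rewrite -natr1; ring.
have [jk|kj|jk] := ltngtP j k.
- have jkR : (j%:R + 1) * mesh n <= k%:R * mesh n :> R.
    by rewrite ler_pM2r// natr1 ler_nat.
  have eu : u = k%:R * mesh n - t / 2.
    by rewrite /u ler0_norm ?opprB// subr_le0; lra.
  have {}ev : v = u + mesh n.
    by rewrite /v ev ler0_norm ?eu; lra.
  have up : 0 < u by lra.
  apply: (far v u) => //; first by rewrite (mulrC v).
  rewrite D0 ler0_norm; last by rewrite subr_le0 ler_nat ltnW.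
  by rewrite ev eu; lra.
- have jkR : (k%:R + 1) * mesh n <= j%:R * mesh n :> R.
    by rewrite ler_pM2r// natr1 ler_nat.
  have eu : v = t / 2 - (k%:R * mesh n + mesh n).
    by rewrite /v ev ger0_norm// subr_ge0; lra.
  have {}ev : u = v + mesh n.
    by rewrite /u ger0_norm ?eu; lra.
  have vp : 0 < v by lra.
  apply: (far u v) => //.
  rewrite D0 ger0_norm; last by rewrite subr_ge0 ler_nat ltnW.
  by rewrite ev eu; lra.
(* On the diagonal u + v = h, so adding the two linear bounds gives q <= 16. *)
- rewrite jk subrr normr0 addr0 mul1r in tl tr ej *.
  have eu : u = t / 2 - k%:R * mesh n by rewrite /u ger0_norm//; lra.
  have {}ev : v = k%:R * mesh n + mesh n - t / 2.
    by rewrite /v ev ler0_norm; lra.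
  have up : 0 < u by lra.
  have vp : 0 < v by lra.
  move: vq uq; rewrite !ler_pM2l// => vq uq.
  have e : mesh n = u + v by rewrite eu ev; ring.
  have := ler_wpM2l (ltW h0) (lerD uq vq).
  rewrite -mulrDl -e expr2 => l.
  have h2 : 0 <= mesh n * mesh n :> R by rewrite mulr_ge0// ltW.
  lra.
Qed.

(** The kernel is continuous, so the bound passes to the endpoints by a one-sided limit from inside
    the interval. *)
Lemma gk_kernel_closed (R : realType) (n j k : nat) (t : R) :
  (j < n)%N -> (k < n)%N ->
  2 * j%:R * mesh n <= t <= 2 * j.+1%:R * mesh n ->
  `|gk_kernel n k t| <= gk_weight j k.
Proof.
move=> jn kn; have n0 : (0 < n)%N by exact: leq_trans jn.
have h0 := @mesh_gt0 R n n0.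
set l := 2 * j%:R * mesh n; set r := 2 * j.+1%:R * mesh n => /andP[lt tr].
have lr : l < r by rewrite ltr_pM2r// ltr_pM2l// ltr_nat.
have c : `|gk_kernel n k s| @[s --> t] --> `|gk_kernel n k t|.
  by apply: cvg_norm; exact: continuous_gk_kernel.
have [tr'|tr'] := ltP t r.
- apply: (cvgr_to_le (cvg_at_right_filter c)).
  near=> s; apply: (@gk_kernel_open R n j k s jn kn).
  apply/andP; split; first by apply: le_lt_trans lt _; near: s; exact: nbhs_right_gt.
  by near: s; exact: nbhs_right_lt.
- apply: (cvgr_to_le (cvg_at_left_filter c)).
  near=> s; apply: (@gk_kernel_open R n j k s jn kn).
  apply/andP; split.
    by near: s; apply: nbhs_left_gt; exact: lt_le_trans lr _.
  apply: lt_le_trans tr; near: s; exact: nbhs_left_lt.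
Unshelve. all: by end_near. Qed.

(** * Row and column sums of the weights *)

(** One of the two truncated differences is always 0. *)
Lemma norm_natB (R : realType) (j k : nat) :
  `|j%:R - k%:R| = ((j - k) + (k - j))%:R :> R.
Proof.
have [jk|/ltnW kj] := leqP j k.
  rewrite (eqP jk) add0n natrB// distrC ger0_norm// subr_ge0 ler_nat//.
by rewrite (eqP kj) addn0 natrB// ger0_norm// subr_ge0 ler_nat.
Qed.

(** The indices k <= j, in reverse order, and the indices k > j, shifted, each give a sum of F over
    an interval inside [0, n). *)
Lemma sum_dist_le (R : realType) (F : nat -> R) (j n : nat) :
  (forall m, 0 <= F m) -> (j < n)%N ->
  \sum_(k < n) F ((j - k) + (k - j))%N <= 2 * \sum_(m < n) F m.
Proof.
move=> F0 jn.
have mono (a b : nat) : (b <= n)%N -> \sum_(a <= m < b) F m <= \sum_(0 <= m < n) F m.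
  move=> bn; have [ab|/ltnW ba] := leqP a b; last first.
    by rewrite big_geq// sumr_ge0.
  rewrite (big_cat_nat (leq0n a) (leq_trans ab bn))/= (big_cat_nat ab bn)/=.
  by rewrite addrCA lerDl addr_ge0// sumr_ge0.
rewrite -(big_mkord predT (fun k => F ((j - k) + (k - j))%N)) -(big_mkord predT F).
rewrite (big_cat_nat (leq0n j.+1) jn)/=.
rewrite (_ : 2 = 1 + 1)// mulrDl !mul1r lerD//.
  rewrite big_nat_rev/= add0n big_nat_cond [leLHS](_ : _ = \sum_(0 <= m < j.+1) F m).
    exact: mono.
  rewrite [RHS]big_nat_cond; apply: eq_bigr => k /andP[/andP[_ kj] _].
  by congr F; lia.
rewrite -{1}[j.+1]add1n big_addn big_nat_cond
  [leLHS](_ : _ = \sum_(1 <= m < n - j) F m); first by apply: mono; exact: leq_subr.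
by rewrite [RHS]big_nat_cond; apply: eq_bigr => k _; congr F; lia.
Qed.

Lemma sum_inv_sqr_le (R : realType) (n : nat) :
  \sum_(m < n) (1 + m%:R) ^- 2 <= 2 :> R.
Proof.
case: n => [|n]; first by rewrite big_ord0.
(* The strengthened bound makes the induction work, through 1/(n+2)^2 <= 1/(n+1) - 1/(n+2). *)
have : \sum_(m < n.+1) (1 + m%:R) ^- 2 <= 2 - (1 + n%:R)^-1 :> R.
  elim: n => [|n ih]; first by rewrite big_ord1 addr0 expr1n invr1; lra.
  rewrite big_ord_recr/= -natr1; set x : R := n%:R in ih *.
  have x0 : 0 <= x by exact: ler0n.
  suff : (1 + (x + 1)) ^- 2 <= (1 + x)^-1 - (1 + (x + 1))^-1 by lra.
  rewrite -subr_ge0 [leRHS](_ : _ = (1 + x)^-1 * (1 + (x + 1)) ^- 2).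
    by rewrite mulr_ge0// invr_ge0 ?exprn_ge0//; lra.
  by field; apply/andP; split; lra.
have : 0 <= (1 + n%:R)^-1 :> R by rewrite invr_ge0 addr_ge0.
lra.
Qed.

Lemma sum_inv_le (R : realType) (n : nat) : (0 < n)%N ->
  \sum_(m < n) (1 + m%:R)^-1 <= 1 + ln n%:R :> R.
Proof.
case: n => // n _; elim: n => [|n ih].
  by rewrite big_ord1 addr0 invr1 ln1 addr0.
rewrite big_ord_recr/=.
have x0 : 0 < n.+1%:R :> R by rewrite ltr0n.
have y0 : 0 < n.+2%:R :> R by rewrite ltr0n.
have xy : 0 < n.+1%:R / n.+2%:R :> R by exact: divr_gt0.
(* The inequality ln(1 + y) <= y at y = -1/(n+2) reads 1/(n+2) <= ln(n+2) - ln(n+1). *)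
have := le_ln1Dx (_ : - 1 < - n.+2%:R^-1 :> R).
rewrite ltrN2 invf_lt1// ltr1n => /(_ isT).
rewrite (_ : 1 + - _ = n.+1%:R / n.+2%:R); last first.
  by rewrite -(natr1 n.+1) in y0 *; field; rewrite gt_eqF.
rewrite lnM ?posrE ?invr_gt0// lnV ?posrE// => l.
rewrite [1 + n.+1%:R]addrC natr1.
by move: (n.+2%:R^-1) (ln n.+2%:R) (ln n.+1%:R) ih l => u v w; lra.
Qed.

Lemma gk_weight_ge0 (R : realType) (j k : nat) : 0 <= gk_weight j k :> R.
Proof. by rewrite divr_ge0// exprn_ge0// addr_ge0. Qed.

Lemma gk_weightC (R : realType) (j k : nat) : gk_weight j k = gk_weight k j :> R.
Proof. by rewrite /gk_weight distrC. Qed.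

Lemma sum_gk_weight_le (R : realType) (n j : nat) : (j < n)%N ->
  \sum_(k < n) gk_weight j k <= 192 :> R.
Proof.
move=> jn; under eq_bigr do rewrite /gk_weight norm_natB.
rewrite -mulr_sumr.
have F0 (m : nat) : 0 <= (1 + m%:R) ^- 2 :> R.
  by rewrite invr_ge0 exprn_ge0// addr_ge0.
have l1 := @sum_dist_le R _ j n F0 jn.
have l2 := @sum_inv_sqr_le R n.
rewrite (_ : 192 = 48 * (2 * 2)); last by lra.
apply: ler_wpM2l => //; apply: le_trans l1 _; exact: ler_wpM2l.
Qed.

(** One factor of distance turns the quadratic decay into a harmonic sum; this is the source of the
    logarithm. *)
Lemma sum_gk_weightM_le (R : realType) (n j : nat) : (j < n)%N ->
  \sum_(k < n) gk_weight j k * (1 + `|j%:R - k%:R|) <= 96 * (1 + ln n%:R) :> R.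
Proof.
move=> jn; have n0 : (0 < n)%N by exact: leq_trans jn.
have e (k : nat) : gk_weight j k * (1 + `|j%:R - k%:R|) =
    48 * (1 + ((j - k) + (k - j))%:R)^-1 :> R.
  rewrite /gk_weight norm_natB; move: (_ + _)%N => d; field.
  by rewrite addrC natr1 pnatr_eq0.
under eq_bigr do rewrite e.
rewrite -mulr_sumr.
have F0 (m : nat) : 0 <= (1 + m%:R)^-1 :> R by rewrite invr_ge0 addr_ge0.
have l1 := @sum_dist_le R _ j n F0 jn.
have l2 := @sum_inv_le R n n0.
rewrite (_ : 96 = 48 * 2); last by lra.
rewrite -mulrA; apply: ler_wpM2l => //; apply: le_trans l1 _; exact: ler_wpM2l.
Qed.

(** * Lipschitz bound for C1 functions *)

(** The increment g y - g x is the convergent difference quotient times y - x, which tends to 0. *)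
Lemma derivableI_continuous (R : realType) (g : R -> R) :
  (forall x, Ipi x -> derivableI g x) -> {within Ipi, continuous g}.
Proof.
move=> dg; apply/subspace_continuousP => x Ix.
have cq : diff_quotient g x @ within Ipi x^' --> deriveI g x by exact: dg.
have cid : (fun y : R => y - x) @ within Ipi x^' --> x - x.
  do 2!apply: cvg_within_filter.
  by apply: cvgB; [exact: cvg_id|exact: cvg_cst].
have FF : Filter (within Ipi x^') by exact: within_filter.
have := cvgM (FF := FF) cq cid; rewrite subrr mulr0 => /cvgr_dist_lt cm.
apply/cvgrPdist_lt => e e0.
have h : \forall y \near x, y != x -> Ipi y ->
    `|0 - diff_quotient g x y * (y - x)| < e by exact: cm.
suff : \forall y \near x, Ipi y -> `|g x - g y| < e by [].
apply: filterS h => y + Iy.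
have [->|yx] := eqVneq y x; first by move=> _; rewrite subrr normr0.
move=> /(_ isT Iy); rewrite sub0r normrN /diff_quotient.
by rewrite divfK ?subr_eq0// distrC.
Qed.

(** At an interior point nearby values lie in [0, pi], so the relative limit is the ordinary one
    after the substitution y = x + h. *)
Lemma is_derive_deriveI (R : realType) (g : R -> R) (x : R) :
  derivableI g x -> 0 < x < pi -> is_derive x 1 g (deriveI g x).
Proof.
move=> dg /andP[x0 xpi].
have cq : diff_quotient g x @ within Ipi x^' --> deriveI g x by exact: dg.
have cs : (fun h : R => h *: 1 + x) @ 0^' --> within Ipi x^'.
  have ch : (fun h : R => h *: 1 + x) @ 0 --> x.
    rewrite -[X in _ --> X]add0r; apply: cvgD; last exact: cvg_cst.
    rewrite -[X in _ --> X](mul0r (1 : R)).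
    by apply: cvgMr_tmp; exact: cvg_id.
  move=> A nA.
  have {}nA : \forall y \near x, y != x -> Ipi y -> A y by exact: nA.
  have [U nU] : exists2 U, nbhs x U & forall y, U y -> y != x -> A y.
    have I : nbhs x [set y : R | 0 < y < pi].
      near=> y; apply/andP; split; near: y; first exact: lt_nbhsr.
      exact: lt_nbhsl.
    exists ([set y : R | 0 < y < pi] `&` [set y | y != x -> Ipi y -> A y]).
      exact: filterI.
    move=> y [/andP[y0 ypi] Ay] yx; apply: Ay => //.
    by rewrite /Ipi/= in_itv/= !ltW.
  move=> UA; have nearU : \forall h \near (0 : R), U (h *: 1 + x) by exact: ch.
  suff : \forall h \near (0 : R), h != 0 -> A (h *: 1 + x) by [].
  apply: filterS nearU => h Uh h0.
  by apply: UA => //; rewrite -subr_eq0 addrK scaler_eq0 negb_or h0 oner_eq0.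
have c : h^-1 *: ((g \o shift x) (h *: 1) - g x) @[h --> 0^'] --> deriveI g x.
  apply: cvg_trans (cvg_comp _ _ cs cq); apply: near_eq_cvg; near=> h.
  by rewrite /= /diff_quotient addrK mulrC /GRing.scale/= mulr1.
apply: DeriveDef; last exact: cvg_lim c.
by apply/cvg_ex; exists (deriveI g x).
Unshelve. all: by end_near. Qed.

Lemma C1I_lipschitz (R : realType) (g : R -> R) (L : R) :
  C1I g -> (forall x, Ipi x -> `|deriveI g x| <= L) ->
  forall x y, Ipi x -> Ipi y -> `|g x - g y| <= L * `|x - y|.
Proof.
move=> [dg _] bL.
have lip (x y : R) : Ipi x -> Ipi y -> x <= y -> `|g y - g x| <= L * `|y - x|.
  rewrite /Ipi/= !in_itv/= => /andP[x0 xpi] /andP[y0 ypi] xy.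
  have Isub (z : R) : x <= z <= y -> Ipi z.
    move=> /andP[xz zy]; rewrite /Ipi/= in_itv/=.
    by rewrite (le_trans x0 xz) (le_trans zy ypi).
  have [||c cxy ->] := @MVT_segment R g (deriveI g) x y xy.
  - move=> z; rewrite in_itv/= => /andP[xz zy]; apply: is_derive_deriveI.
      by apply/dg/Isub; rewrite !ltW.
    by rewrite (le_lt_trans x0 xz) (lt_le_trans zy ypi).
  - apply: continuous_subspaceW (derivableI_continuous R g dg) => z /=.
    by rewrite in_itv/=; exact: Isub.
  by rewrite normrM ler_wpM2r//; apply/bL/Isub; move: cxy; rewrite in_itv.
move=> x y Ix Iy; have [xy|/ltW yx] := leP x y; last exact: lip.
by rewrite distrC (distrC x); exact: lip.
Qed.

(** * Averages and the power function *)

Local Notation mu := (@lebesgue_measure _).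

Lemma measurable_Ipi (R : realType) : measurable (Ipi : set (measurableTypeR R)).
Proof. exact: measurable_itv. Qed.

Lemma lebesgue_measure_itvcc (R : realType) (a b : R) : a <= b ->
  lebesgue_measure (`[a, b] : set (measurableTypeR R)) = (b - a)%:E.
Proof.
move=> ab; rewrite lebesgue_measure_itv/= lte_fin; case: ltP => //= ba.
by congr EFin; apply/esym/eqP; rewrite subr_eq0 eq_le ab ba.
Qed.

Lemma integrable_cst_itv (R : realType) (a b c : R) :
  mu.-integrable `[a, b] (EFin \o cst c).
Proof.
apply: continuous_compact_integrable; first exact: segment_compact.
exact/continuous_subspaceT/cst_continuous.
Qed.

Lemma measurable_norm_powR {R : realType} (D : set (measurableTypeR R)) (u : measurableTypeR R -> R) (p : R) :
  measurable_fun D u -> measurable_fun D (fun x => `|u x| `^ p).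
Proof.
move=> mu_; apply: (measurableT_comp (measurable_powR _)).
exact: measurableT_comp.
Qed.

(** For x > s, write x = x^(1-p) x^p and use that the exponent 1 - p is not positive. The free
    parameter [s] is optimized later. *)
Lemma le_addr_powR (R : realType) (p s x : R) : 1 <= p -> 0 < s -> 0 <= x ->
  x <= s + s `^ (1 - p) * x `^ p.
Proof.
move=> p1 s0 x0; have [xs|/ltW sx] := leP x s.
  by rewrite (le_trans xs)// lerDl mulr_ge0// powR_ge0.
rewrite -[leLHS]add0r lerD ?(ltW s0)//.
have {}x0 : 0 < x by exact: lt_le_trans sx.
rewrite -{1}(powRr1 (ltW x0)) -[X in x `^ X](subrK p) powRD; last first.
  by apply/implyP => _; rewrite gt_eqF.
rewrite ler_wpM2r ?powR_ge0//.
rewrite -opprB !powRN lef_pV2 ?posrE ?powR_gt0//.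
by apply: ge0_ler_powR; rewrite ?subr_ge0 ?nnegrE// ltW.
Qed.

(** On a bounded interval 1 + |u|^p is an integrable majorant of |u|. *)
Lemma powR_integrable (R : realType) (p a b : R) (u : measurableTypeR R -> R) : 1 <= p ->
  measurable_fun `[a, b] u ->
  mu.-integrable `[a, b] (EFin \o (fun x => `|u x| `^ p)) ->
  mu.-integrable `[a, b] (EFin \o u).
Proof.
move=> p1 mu_ iu; have mab : measurable (`[a, b] : set (measurableTypeR R)) by exact: measurable_itv.
pose w x := `|u x| `^ p.
apply: (@le_integrable _ _ _ mu _ mab _ (EFin \o (fun x => 1 + w x))).
- exact/measurable_EFinP.
- move=> x _ /=; rewrite lee_fin [leRHS]ger0_norm ?addr_ge0 ?powR_ge0//.
  have := @le_addr_powR R p 1 `|u x| p1 ltr01 (normr_ge0 _).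
  by rewrite powR1 mul1r.
- by have := integrableD mab (integrable_cst_itv R a b 1) iu; apply: eq_integrable.
Qed.

Lemma Rintegral_norm_le_powR (R : realType) (p a b s : R) (u : measurableTypeR R -> R) :
  1 <= p -> 0 < s -> a <= b -> measurable_fun `[a, b] u ->
  mu.-integrable `[a, b] (EFin \o (fun x => `|u x| `^ p)) ->
  \int[mu]_(x in `[a, b]) `|u x| <=
  s * (b - a) + s `^ (1 - p) * \int[mu]_(x in `[a, b]) (`|u x| `^ p).
Proof.
move=> p1 s0 ab mu_ iu; have mab : measurable (`[a, b] : set (measurableTypeR R)) by exact: measurable_itv.
have iN := integrable_norm (powR_integrable R p a b u p1 mu_ iu).
have iS : mu.-integrable `[a, b] (EFin \o (fun x => s `^ (1 - p) * `|u x| `^ p)).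
  by have := integrableZl mab (s `^ (1 - p)) iu; apply: eq_integrable.
have ic := integrable_cst_itv R a b s.
rewrite -RintegralZl// -[X in X + _](_ : \int[mu]_(x in `[a, b]) cst s x = _).
  rewrite -RintegralD//; apply: le_Rintegral => //.
    by have := integrableD mab ic iS; apply: eq_integrable.
  by move=> x _; exact: le_addr_powR.
rewrite Rintegral_cst//; congr (_ * _).
exact: (congr1 fine (lebesgue_measure_itvcc R a b ab)).
Qed.

(* Optimizing over [s] replaces Jensen's inequality, up to a constant. *)
Lemma powR_le_of_family (R : realType) (p X D W : R) :
  1 <= p -> 0 <= X -> 0 <= D -> 0 <= W ->
  (forall s, 0 < s -> X <= W * s + s `^ (1 - p) * D) ->
  X `^ p <= (W + 1) `^ p * D.
Proof.
move=> p1 X0 D0 W0 XD; have p0 : 0 < p by exact: lt_le_trans p1.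
have W1 : 0 <= W + 1 by rewrite addr_ge0.
(* If D = 0, the optimal s would be 0; instead s = e/(W + 1) gives X <= e for every e > 0, so X =
   0. *)
move: D0; rewrite le_eqVlt => /predU1P[D0|D0].
  have {}XD : X = 0.
    apply/eqP; rewrite eq_le X0 andbT; apply/ler_addgt0Pr => e e0.
    have W1' : 0 < W + 1 by lra.
    have := XD _ (divr_gt0 e0 W1'); rewrite -D0 mulr0 addr0 add0r.
    move/le_trans; apply; rewrite mulrA ler_pdivrMr// mulrC.
    by rewrite ler_pM2l//; lra.
  by rewrite XD -D0 mulr0 powR0// gt_eqF.
(* With s^p = D the term s^(1-p) D equals s, so X <= (W + 1) s. *)
pose s := D `^ p^-1; have s0 : 0 < s by exact: powR_gt0.
have sD : s `^ p = D by rewrite /s -powRrM mulVf ?powRr1 ?gt_eqF// ltW.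
have {XD} := XD s s0; rewrite -{1}sD -powRD; last first.
  by apply/implyP => _; rewrite gt_eqF.
rewrite subrK powRr1 ?(ltW s0)// => XW.
rewrite -sD -powRM//; last exact: ltW.
apply: ge0_ler_powR; rewrite ?nnegrE ?(ltW p0)//; last by lra.
by rewrite mulr_ge0// ltW.
Qed.

(** * Pointwise estimate *)

(** The right half of [2kh, 2(k+1)h], so distinct cells are separated by gaps of length at least
    h. *)
Definition gk_cell {R : realType} (n k : nat) : set (measurableTypeR R) :=
  `[theta_node n k.+1, theta_node n k.+1 + mesh n].

Lemma GKE (R : realType) (n : nat) (f : R -> R) (t : R) :
  GK n f t = n%:R / pi *
    \sum_(k < n) (\int[mu]_(x in gk_cell n k) f x) * gk_kernel n k t.
Proof. by rewrite /GK big_add1/= big_mkord. Qed.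

Lemma measurable_gk_cell (R : realType) (n k : nat) : measurable (@gk_cell R n k).
Proof. exact: measurable_itv. Qed.

Lemma gk_cell_itv (R : realType) (n k : nat) (x : R) : gk_cell n k x ->
  (2 * k%:R + 1) * mesh n <= x <= (2 * k%:R + 2) * mesh n.
Proof.
rewrite /gk_cell/= in_itv/= theta_nodeE => /andP[l r]; rewrite l/=.
by apply: le_trans r _; lra.
Qed.

Lemma gk_cell_Ipi (R : realType) (n k : nat) : (k < n)%N ->
  @gk_cell R n k `<=` Ipi.
Proof.
move=> kn x /gk_cell_itv/andP[l r]; have n0 : (0 < n)%N by case: n kn l r.
have h0 := @mesh_gt0 R n n0; have hn := @natM_mesh R n n0.
have k0 : 0 <= k%:R * mesh n :> R by rewrite mulr_ge0// ltW.
have : (k%:R + 1) * mesh n <= n%:R * mesh n :> R.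
  by rewrite ler_pM2r// natr1 ler_nat.
by move=> ?; rewrite /Ipi/= in_itv/=; apply/andP; split; lra.
Qed.

Lemma natM_mesh_pi (R : realType) (n : nat) : (0 < n)%N ->
  n%:R / pi * mesh n = 1 / 2 :> R.
Proof.
move=> n0; rewrite mulrAC natM_mesh// mulrAC divff ?gt_eqF ?pi_gt0//.
Qed.

Lemma Rintegral_gk_cell_cst (R : realType) (n k : nat) (c : R) : (0 < n)%N ->
  \int[mu]_(x in gk_cell n k) c = c * mesh n.
Proof.
move=> n0; have h0 := @mesh_gt0 R n n0.
rewrite Rintegral_cst; last exact: measurable_gk_cell.
have l : theta_node n k.+1 <= theta_node n k.+1 + mesh n :> R.
  by rewrite lerDl ltW.
congr (_ * _); rewrite [RHS](_ : _ = fine (theta_node n k.+1 + mesh n - theta_node n k.+1)%:E).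
  exact: (congr1 fine (lebesgue_measure_itvcc R _ _ l)).
by rewrite /= addrAC subrr add0r.
Qed.

(** Since constants are reproduced, decompose f(x) on each cell as f(t) + (f - g)(x) - (f - g)(t) +
    (g(x) - g(t)). The last three pieces give the three terms of the bound. *)
Lemma GK_sub_le (R : realType) (n j : nat) (f g : measurableTypeR R -> R) (L t : R) :
  (j < n)%N -> 2 * j%:R * mesh n <= t <= 2 * j.+1%:R * mesh n ->
  mu.-integrable Ipi (EFin \o f) -> mu.-integrable Ipi (EFin \o g) ->
  (forall x y, Ipi x -> Ipi y -> `|g x - g y| <= L * `|x - y|) -> 0 <= L ->
  `|GK n f t - f t| <=
    n%:R / pi * \sum_(k < n) gk_weight j k * \int[mu]_(x in gk_cell n k) `|f x - g x|
    + `|f t - g t| + 192 * L * ((1 + ln n%:R) / n%:R).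
Proof.
move=> jn tj jf jg lip L0; have n0 : (0 < n)%N by exact: leq_trans jn.
have h0 := @mesh_gt0 R n n0; have hn := @natM_mesh R n n0.
have np0 : 0 <= n%:R / pi :> R by rewrite divr_ge0// pi_ge0.
have mI := @measurable_Ipi R.
have sub (F : measurableTypeR R -> R) (k : 'I_n) :
    mu.-integrable Ipi (EFin \o F) -> mu.-integrable (gk_cell n k) (EFin \o F).
  by apply: integrableS => //; [exact: measurable_gk_cell|exact: gk_cell_Ipi].
have ic (k : nat) (c : R) : mu.-integrable (gk_cell n k) (EFin \o cst c).
  exact: integrable_cst_itv.
have mC := @measurable_gk_cell R n.
pose G (k : nat) := \int[mu]_(x in gk_cell n k) (g x - g t).
pose U (k : nat) := \int[mu]_(x in gk_cell n k) (f x - g x).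
have fE (k : 'I_n) : \int[mu]_(x in gk_cell n k) f x =
    f t * mesh n + (U k - (f t - g t) * mesh n + G k).
  rewrite /U /G RintegralB//; [|exact: sub|exact: sub].
  rewrite RintegralB//; [|exact: sub|exact: ic].
  by rewrite Rintegral_gk_cell_cst//; ring.
have Q2 := @sum_gk_kernel R n t n0.
have sQ (c : R) : n%:R / pi * \sum_(k < n) c * mesh n * gk_kernel n k t = c.
  rewrite -mulr_sumr Q2 [LHS](_ : _ = c * 2 * (n%:R / pi * mesh n)); last by ring.
  by rewrite natM_mesh_pi//; lra.
have -> : GK n f t - f t = n%:R / pi * (\sum_(k < n) U k * gk_kernel n k t)
    - (f t - g t) + n%:R / pi * (\sum_(k < n) G k * gk_kernel n k t).
  rewrite GKE.
  under eq_bigr => k _ do rewrite fE mulrDl mulrDl mulrBl.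
  rewrite !big_split/= sumrN !mulrDr mulrN !sQ; ring.
have Qw (k : 'I_n) : `|gk_kernel n k t| <= gk_weight j k.
  by apply: gk_kernel_closed jn _ tj.
have sumle (V W : nat -> R) : (forall k : 'I_n, `|V k| <= W k) ->
    `|n%:R / pi * (\sum_(k < n) V k * gk_kernel n k t)| <=
    n%:R / pi * \sum_(k < n) gk_weight j k * W k.
  move=> VW; rewrite normrM (ger0_norm np0) ler_wpM2l//.
  apply: le_trans (ler_norm_sum _ _ _) _; apply: ler_sum => k _.
  by rewrite normrM mulrC ler_pM.
apply: le_trans (ler_normD _ _) _; apply: lerD.
  apply: le_trans (ler_normB _ _) _; rewrite lerD2r.
  apply: (sumle U (fun k => \int[mu]_(x in gk_cell n k) `|f x - g x|)) => k.
  apply: (le_normr_Rintegral (mC k)).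
  by have := integrableB (mC k) (sub _ k jf) (sub _ k jg); apply: eq_integrable.
have ln0 : 0 <= 1 + ln n%:R :> R by rewrite addr_ge0// ln_ge0// ler1n.
(* A point of cell k is within 2h(1 + |j - k|) of t, and the cell has length h. *)
pose B (k : nat) := 2 * L * mesh n * (1 + `|j%:R - k%:R|) * mesh n.
have GW (k : 'I_n) : `|G k| <= B k.
  have iG : mu.-integrable (gk_cell n k) (EFin \o (fun x => g x - g t)).
    have := integrableB (mC k) (sub _ k jg) (ic k (g t)).
    by apply: eq_integrable.
  apply: le_trans (le_normr_Rintegral (mC k) iG) _.
  rewrite /B -(Rintegral_gk_cell_cst R n k)//; apply: le_Rintegral => //.
  - exact: integrable_norm iG.
  - exact: ic.
  move=> x cx; have tI : Ipi t.
    have j0 : 0 <= 2 * j%:R * mesh n :> R by apply: mulr_ge0 (ltW h0); exact: mulr_ge0.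
    have : j.+1%:R * mesh n <= n%:R * mesh n :> R by rewrite ler_pM2r// ler_nat.
    case/andP: tj => tl tr.
    by move=> ?; rewrite /Ipi/= in_itv/=; apply/andP; split; lra.
  apply: le_trans (lip _ _ (gk_cell_Ipi _ _ _ (ltn_ord k) _ cx) tI) _.
  rewrite [leRHS](_ : _ = L * (2 * mesh n * (1 + `|j%:R - k%:R|))); last by ring.
  apply: ler_wpM2l => //.
  have [cl cr] := andP (gk_cell_itv _ _ _ _ cx); have [tl tr] := andP tj.
  rewrite -[j.+1%:R]natr1 in tr.
  have d1 := ler_wpM2r (ltW h0) (ler_norm (j%:R - k%:R : R)).
  have d2 := ler_wpM2r (ltW h0) (ler_norm (k%:R - j%:R : R)).
  rewrite distrC in d2.
  by rewrite ler_norml; apply/andP; split; lra.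
apply: le_trans (sumle _ _ GW) _.
rewrite (eq_bigr (fun k : 'I_n => 2 * L * mesh n * mesh n *
    (gk_weight j k * (1 + `|j%:R - k%:R|)))); last by move=> k _; rewrite /B; ring.
rewrite -mulr_sumr.
have S := @sum_gk_weightM_le R n j jn.
have c0 : 0 <= L * mesh n by rewrite mulr_ge0// ltW.
rewrite (_ : n%:R / pi * (2 * L * mesh n * mesh n * _) =
  n%:R / pi * mesh n * 2 * (L * mesh n) * \sum_(k < n) gk_weight j k * (1 + `|j%:R - k%:R|)); last by ring.
rewrite natM_mesh_pi// (_ : 1 / 2 * 2 = 1); last by lra.
rewrite mul1r; apply: le_trans (ler_wpM2l c0 S) _.
(* As h = pi/2n, the constant 96h is 48 pi/n, and pi < 4 gives 192. *)
rewrite (_ : L * mesh n * _ = 48 * pi * (L * ((1 + ln n%:R) / n%:R))).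
  rewrite -[leRHS]mulrA; apply: ler_wpM2r; first by rewrite mulr_ge0// divr_ge0.
  by have := @pihalf_lt2 R; lra.
by rewrite /mesh; field; rewrite pnatr_eq0 -lt0n.
Qed.

(** * Integral estimate *)

Lemma exists_mesh_interval (R : realType) (n : nat) (t : R) : (0 < n)%N ->
  Ipi t -> exists2 j : nat, (j < n)%N &
    2 * j%:R * mesh n <= t <= 2 * j.+1%:R * mesh n.
Proof.
move=> n0; rewrite /Ipi/= in_itv/= => /andP[t0 tpi].
have h0 := @mesh_gt0 R n n0; have hn := @natM_mesh R n n0.
have tn : t <= 2 * n%:R * mesh n by rewrite -mulrA hn; lra.
suff H (m : nat) : (0 < m)%N -> t <= 2 * m%:R * mesh n -> exists2 j : nat,
    (j < m)%N & 2 * j%:R * mesh n <= t <= 2 * j.+1%:R * mesh n by exact: H.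
elim: m => // m ih _ tm.
have [tlt|tge] := leP t (2 * m%:R * mesh n).
  case: m ih tm tlt => [|m] ih tm tlt; first by exists 0%N; rewrite // mulr0 mul0r t0.
  by have [j jm jt] := ih isT tlt; exists j => //; exact: ltnW.
by exists m => //; rewrite tm (ltW tge).
Qed.

(** The sum is at most three times its largest term. *)
Lemma powR_add3_le (R : realType) (p x y z : R) : 0 <= p ->
  0 <= x -> 0 <= y -> 0 <= z ->
  (x + y + z) `^ p <= 3 `^ p * (x `^ p + y `^ p + z `^ p).
Proof.
move=> p0 x0 y0 z0.
have key (w : R) : 0 <= w -> x <= w -> y <= w -> z <= w ->
    (x + y + z) `^ p <= 3 `^ p * w `^ p.
  move=> w0 xw yw zw; rewrite -powRM//.
  by apply: ge0_ler_powR; rewrite ?nnegrE//; lra.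
have x1 := powR_ge0 x p; have y1 := powR_ge0 y p; have z1 := powR_ge0 z p.
have fin (w : R) : w `^ p <= x `^ p + y `^ p + z `^ p ->
    3 `^ p * w `^ p <= 3 `^ p * (x `^ p + y `^ p + z `^ p).
  by move=> ?; rewrite ler_wpM2l// powR_ge0.
have [xy|/ltW yx] := leP x y; [have [yz|/ltW zy] := leP y z|have [xz|/ltW zx] := leP x z].
- by apply: le_trans (key z _ _ _ _) (fin z _) => //; lra.
- by apply: le_trans (key y _ _ _ _) (fin y _) => //; lra.
- by apply: le_trans (key z _ _ _ _) (fin z _) => //; lra.
- by apply: le_trans (key x _ _ _ _) (fin x _) => //; lra.
Qed.

(** The row-sum half of Schur's test: the parametric inequality is summed over the cells. The
    weights have total mass at most (n/pi) h 192 = 96, and [powR_le_of_family] adds 1. *)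
Lemma gk_weight_average_powR (R : realType) (p : R) (n j : nat)
    (u : measurableTypeR R -> R) : 1 <= p -> (j < n)%N ->
  measurable_fun (Ipi : set (measurableTypeR R)) u ->
  mu.-integrable Ipi (EFin \o (fun x => `|u x| `^ p)) ->
  (n%:R / pi * \sum_(k < n) gk_weight j k * \int[mu]_(x in gk_cell n k) `|u x|) `^ p <=
  97 `^ p * (n%:R / pi *
    \sum_(k < n) gk_weight j k * \int[mu]_(x in gk_cell n k) (`|u x| `^ p)).
Proof.
move=> p1 jn mU iU; have n0 : (0 < n)%N by exact: leq_trans jn.
have h0 := @mesh_gt0 R n n0.
have np0 : 0 <= n%:R / pi :> R by rewrite divr_ge0// pi_ge0.
have mC := @measurable_gk_cell R n; have mI := @measurable_Ipi R.
have pos (F : R -> R) : (forall x, 0 <= F x) ->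
    0 <= n%:R / pi * \sum_(k < n) gk_weight j k * \int[mu]_(x in gk_cell n k) F x.
  move=> F0; rewrite mulr_ge0// sumr_ge0// => k _.
  by rewrite mulr_ge0 ?gk_weight_ge0// Rintegral_ge0.
rewrite (_ : 97 = 96 + 1); last by lra.
apply: powR_le_of_family => //.
- by apply: pos => x.
- by apply: pos => x; exact: powR_ge0.
move=> s s0.
have a (k : 'I_n) : \int[mu]_(x in gk_cell n k) `|u x| <=
    s * mesh n + s `^ (1 - p) * \int[mu]_(x in gk_cell n k) (`|u x| `^ p).
  have sub := @gk_cell_Ipi R n k (ltn_ord k).
  have l : theta_node n k.+1 <= theta_node n k.+1 + mesh n :> R.
    by rewrite lerDl ltW.
  rewrite [X in s * X](_ : _ = theta_node n k.+1 + mesh n - theta_node n k.+1); last by ring.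
  apply: Rintegral_norm_le_powR => //; first exact: measurable_funS mU.
  exact: integrableS iU.
have W := @sum_gk_weight_le R n j jn.
set A := fun k : nat => \int[mu]_(x in gk_cell n k) (`|u x| `^ p).
apply: (@le_trans _ _ (n%:R / pi * \sum_(k < n)
    (s * mesh n * gk_weight j k + s `^ (1 - p) * (gk_weight j k * A k)))).
  apply: ler_wpM2l => //; apply: ler_sum => k _.
  have := ler_wpM2l (@gk_weight_ge0 R j k) (a k).
  by move/le_trans; apply; rewrite /A le_eqVlt; apply/orP; left; apply/eqP; ring.
rewrite big_split/= -(mulr_sumr _ _ _ (s * mesh n)) -(mulr_sumr _ _ _ (s `^ (1 - p))).
rewrite mulrDr; apply: lerD; last first.
  by rewrite le_eqVlt; apply/orP; left; apply/eqP; rewrite /A; ring.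
rewrite [leLHS](_ : _ = (n%:R / pi * mesh n) * s * \sum_(k < n) gk_weight j k); last by ring.
rewrite natM_mesh_pi//.
have := ler_wpM2l (ltW s0) W; lra.
Qed.

Lemma sum_Rintegral_gk_cell_le (R : realType) (n : nat) (F : measurableTypeR R -> R) :
  mu.-integrable Ipi (EFin \o F) -> (forall x, 0 <= F x) ->
  \sum_(k < n) \int[mu]_(x in gk_cell n k) F x <= \int[mu]_(x in Ipi) F x.
Proof.
move=> iF F0; have mI := @measurable_Ipi R.
have mC := @measurable_gk_cell R n.
have [->|n0] := posnP n; first by rewrite big_ord0 Rintegral_ge0.
have h0 := @mesh_gt0 R n n0.
have iC (k : 'I_n) : mu.-integrable (gk_cell n k) (EFin \o F).
  by apply: integrableS iF => //; exact: gk_cell_Ipi.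
have fE (k : 'I_n) : (\int[mu]_(x in gk_cell n k) F x)%:E =
    (\int[mu]_(x in gk_cell n k) (F x)%:E)%E.
  by rewrite /Rintegral fineK//; exact: integrable_fin_num.
rewrite -lee_fin -sumEFin; under eq_bigr do rewrite fE.
rewrite /Rintegral fineK; last exact: integrable_fin_num.
have mF : measurable_fun (Ipi : set (measurableTypeR R)) (EFin \o F).
  exact: measurable_int iF.
have sub (s : seq 'I_n) :
    \big[setU/set0]_(k <- s) gk_cell n k `<=` (Ipi : set (measurableTypeR R)).
  elim: s => [|k s ih]; first by rewrite big_nil; exact: sub0set.
  by rewrite big_cons subUset; split => //; exact: gk_cell_Ipi.
rewrite -(@ge0_integral_bigsetU _ _ _ mu 'I_n (fun k : 'I_n => gk_cell n k) (EFin \o F))//.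
- apply: ge0_subset_integral => //; first exact: bigsetU_measurable.
  by move=> x _; rewrite lee_fin.
- exact: index_enum_uniq.
- apply/trivIsetP => k l _ _ kl; rewrite -subset0 => x [/gk_cell_itv kx /gk_cell_itv lx].
  have [kx1 kx2] := andP kx; have [lx1 lx2] := andP lx.
  have sep (a b : nat) : (a < b)%N ->
      (2 * b%:R + 1) * mesh n <= x -> x <= (2 * a%:R + 2) * mesh n -> False.
    move=> ab bx ax; have : (a%:R + 1) * mesh n <= b%:R * mesh n :> R.
      by rewrite ler_pM2r// natr1 ler_nat.
    lra.
  have [kl'|lk|/ord_inj e] := ltngtP k l.
  + exact: sep kl' lx1 kx2.
  + exact: sep lk kx1 lx2.
  + by rewrite e eqxx in kl.
- exact: measurable_funS mF.
- by move=> x _; rewrite lee_fin.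
Qed.

Lemma measurable_GK (R : realType) (n : nat) (f : R -> R) :
  measurable_fun setT (GK n f).
Proof.
apply: continuous_measurable_fun.
rewrite (_ : GK n f = fun t => n%:R / pi *
  \sum_(k < n) (\int[mu]_(x in gk_cell n k) f x) * gk_kernel n k t); last first.
  by apply/funext => t; exact: GKE.
move=> t; apply: cvgMl_tmp; apply: continuous_sumr => k s.
by apply: cvgMl_tmp; exact: continuous_gk_kernel.
Qed.

(** The p-th power of the pointwise bound is integrated interval by interval, and the column sums
    complete Schur's test. The left side stays an extended real, so its finiteness is a conclusion;
    the factor 4 bounds the length pi. *)
Lemma integral_GK_sub_le (R : realType) (p : R) (n : nat)
    (f g : measurableTypeR R -> R) (L : R) :
  1 <= p -> (0 < n)%N ->
  mu.-integrable Ipi (EFin \o f) -> mu.-integrable Ipi (EFin \o g) ->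
  mu.-integrable Ipi (EFin \o (fun x => `|f x - g x| `^ p)) ->
  (forall x y, Ipi x -> Ipi y -> `|g x - g y| <= L * `|x - y|) -> 0 <= L ->
  (\int[mu]_(x in Ipi) (`|GK n f x - f x| `^ p)%:E <=
   (3 `^ p * ((97 `^ p * 192 + 1) * (\int[mu]_(x in Ipi) (`|f x - g x| `^ p))
     + 4 * (192 * L * ((1 + ln n%:R) / n%:R)) `^ p))%:E)%E.
Proof.
move=> p1 n0 jf jg ju lip L0.
have h0 := @mesh_gt0 R n n0.
have p0 : 0 <= p by lra.
have mI := @measurable_Ipi R.
have mf : measurable_fun (Ipi : set (measurableTypeR R)) f.
  by apply/measurable_EFinP; exact: measurable_int jf.
have mg : measurable_fun (Ipi : set (measurableTypeR R)) g.
  by apply/measurable_EFinP; exact: measurable_int jg.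
pose u : measurableTypeR R -> R := fun x => f x - g x.
have mU : measurable_fun (Ipi : set (measurableTypeR R)) u by exact: measurable_funB.
set Z := 192 * L * _.
have Z0 : 0 <= Z.
  apply: mulr_ge0; first exact: mulr_ge0.
  by apply: divr_ge0 => //; rewrite addr_ge0// ln_ge0// ler1n.
set b := 3 `^ p; have b0 : 0 <= b by exact: powR_ge0.
pose A (k : nat) := \int[mu]_(x in gk_cell n k) (`|u x| `^ p).
have A0 (k : nat) : 0 <= A k by apply: Rintegral_ge0 => x _; exact: powR_ge0.
have np0 : 0 <= n%:R / pi :> R by rewrite divr_ge0// pi_ge0.
pose D (j : nat) := n%:R / pi * \sum_(k < n) gk_weight j k * A k.
have D0 (j : nat) : 0 <= D j.
  apply: mulr_ge0 => //; apply: sumr_ge0 => k _.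
  by apply: mulr_ge0 => //; exact: gk_weight_ge0.
pose C (j : nat) := b * (97 `^ p * D j).
have C0 (j : nat) : 0 <= C j.
  by apply: mulr_ge0 => //; apply: mulr_ge0 => //; exact: powR_ge0.
pose J (j : nat) : set (measurableTypeR R) :=
  `[2 * j%:R * mesh n, 2 * j.+1%:R * mesh n]%classic.
have mJ (j : nat) : measurable (J j) by exact: measurable_itv.
have muJ (j : nat) : (mu (J j `&` Ipi) <= (2 * mesh n)%:E)%E.
  apply: (@le_trans _ _ (mu (J j))).
    by apply: le_measure; rewrite ?inE//; exact: measurableI.
  have l : 2 * j%:R * mesh n <= 2 * j.+1%:R * mesh n :> R.
    by rewrite ler_pM2r// ler_pM2l// ler_nat.
  rewrite (lebesgue_measure_itvcc R _ _ l) lee_fin -[j.+1%:R]natr1; lra.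
(* The closed intervals [J j] share endpoints; since [C j] >= 0, the overlap only enlarges this
   majorant. *)
pose H1 t := (\sum_(j < n) (C j)%:E * (\1_(J j) t)%:E)%E.
pose H2 t := (b%:E * (`|u t| `^ p)%:E)%E.
have H10 t : (0 <= H1 t)%E.
  by apply: sume_ge0 => j _; rewrite mule_ge0// lee_fin.
have H20 t : (0 <= H2 t)%E by rewrite mule_ge0// lee_fin// powR_ge0.
have mH1 : measurable_fun (Ipi : set (measurableTypeR R)) H1.
  apply: emeasurable_sum => j.
  by apply/measurable_EFinP; apply: measurable_funM => //.
have mH2 : measurable_fun (Ipi : set (measurableTypeR R)) H2.
  by apply/measurable_EFinP; apply: measurable_funM => //; exact: measurable_norm_powR.
have mcst (c : R) : measurable_fun (Ipi : set (measurableTypeR R)) (cst c%:E).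
  exact: measurable_cst.
have bZ0 : 0 <= b * Z `^ p by rewrite mulr_ge0// powR_ge0.
apply: (@le_trans _ _ (\int[mu]_(x in Ipi) (H1 x + (H2 x + (b * Z `^ p)%:E)))%E).
  apply: ge0_le_integral => //.
  - apply/measurable_EFinP; apply: measurable_norm_powR; apply: measurable_funB => //.
    exact: measurable_funTS (measurable_GK _ _ _).
  - by apply: emeasurable_funD => //; exact: emeasurable_funD.
  move=> t It; have [j jn jt] := exists_mesh_interval R n t n0 It.
  have l1 := GK_sub_le R n j f g L t jn jt jf jg lip L0.
  have l2 := gk_weight_average_powR R p n j u p1 jn mU ju.
  set X := n%:R / pi * _ in l1 l2.
  have X0 : 0 <= X.
    rewrite mulr_ge0// sumr_ge0// => k _.
    by rewrite mulr_ge0 ?gk_weight_ge0// Rintegral_ge0.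
  have l3 : `|GK n f t - f t| `^ p <= (X + `|u t| + Z) `^ p.
    by apply: ge0_ler_powR; rewrite ?nnegrE// !addr_ge0.
  apply: (@le_trans _ _ ((C j)%:E + (H2 t + (b * Z `^ p)%:E))%E).
    rewrite /H2 -EFinM -!EFinD lee_fin; apply: le_trans l3 _.
    apply: le_trans (powR_add3_le _ _ _ _ _ _ _ _ _) _ => //.
    by rewrite -/b !mulrDr -!addrA lerD2r ler_wpM2l.
  rewrite leeD2r// /H1 (bigD1 (Ordinal jn))//= indicE mem_set// mule1 leeDl//.
  by apply: sume_ge0 => i _; rewrite mule_ge0// lee_fin.
rewrite ge0_integralD//; last 2 first.
- by move=> x _; rewrite adde_ge0// lee_fin.
- exact: emeasurable_funD.
rewrite ge0_integralD//.
rewrite ge0_integral_sum//; last 2 first.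
- by move=> j; apply/measurable_EFinP; apply: measurable_funM.
- by move=> j x _; rewrite mule_ge0// lee_fin.
rewrite ge0_integralZl_EFin//; last first.
  by apply/measurable_EFinP; exact: measurable_norm_powR.
have IE : (\int[mu]_(x in Ipi) (`|u x| `^ p)%:E =
    (\int[mu]_(x in Ipi) (`|u x| `^ p))%:E)%E.
  by rewrite /Rintegral fineK//; exact: integrable_fin_num.
rewrite IE (integral_cst mu mI).
set E := \int[mu]_(x in Ipi) (`|u x| `^ p).
have sAE : \sum_(k < n) A k <= E.
  by apply: sum_Rintegral_gk_cell_le => // x; exact: powR_ge0.
have s1 : (\sum_(j < n) \int[mu]_(x in Ipi) ((C j)%:E * (\1_(J j) x)%:E) <=
    (\sum_(j < n) C j * (2 * mesh n))%:E)%E.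
  rewrite -sumEFin; apply: lee_sum => j _.
  rewrite ge0_integralZl_EFin//; last exact/measurable_EFinP.
  rewrite integral_indic// [leRHS]EFinM; apply: lee_wpmul2l; last exact: muJ.
  by rewrite lee_fin; exact: C0.
have s2 : \sum_(j < n) C j * (2 * mesh n) <= b * (97 `^ p * 192 * E).
  rewrite -mulr_suml -mulr_sumr -mulrA; apply: ler_wpM2l => //.
  rewrite -mulr_sumr -!mulrA; apply: ler_wpM2l; first exact: powR_ge0.
  rewrite /D -mulr_sumr.
  rewrite [leLHS](_ : _ = n%:R / pi * mesh n * 2 *
    \sum_(j < n) \sum_(k < n) gk_weight j k * A k); last by ring.
  (* After the exchange, symmetry of the weights bounds the column sums by the row-sum constant
     192. *)
  rewrite natM_mesh_pi// exchange_big/=.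
  apply: (@le_trans _ _ (\sum_(k < n) 192 * A k)).
    rewrite (_ : 1 / 2 * 2 = 1); last by lra.
    rewrite mul1r; apply: ler_sum => k _; rewrite -mulr_suml ler_wpM2r//.
    by under eq_bigr do rewrite gk_weightC; exact: sum_gk_weight_le.
  by rewrite -mulr_sumr ler_wpM2l.
have muI : (lebesgue_measure (Ipi : set (measurableTypeR R)) <= 4%:E)%E.
  rewrite (lebesgue_measure_itvcc R 0 pi (@pi_ge0 R)) lee_fin.
  by have := @pihalf_lt2 R; lra.
apply: (@le_trans _ _ ((b * (97 `^ p * 192 * E))%:E + ((b * E)%:E + (b * Z `^ p * 4)%:E))%E).
  apply: leeD; first by apply: le_trans s1 _; rewrite lee_fin.
  apply: leeD => //; rewrite [leRHS]EFinM; apply: lee_wpmul2l; last exact: muI.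
  by rewrite lee_fin.
by rewrite -!EFinD lee_fin /u; lra.
Qed.

(** * The theorem *)

(** The extension by 0 contributes nothing outside [0, pi] because 0^p = 0 for p > 0. *)
Lemma normLpI_powR (R : realType) (p : R) (F : R -> R) : 1 <= p ->
  (normLpI p F `^ p = \int[mu]_(x in Ipi) (`|F x| `^ p)%:E)%E.
Proof.
move=> p1; rewrite /normLpI powR_Lnorm ?gt_eqF//; last by lra.
rewrite [RHS]integral_mkcond; apply: eq_integral => x _.
rewrite /patch/=; case: ifPn => // _.
by rewrite normr0 powR0// gt_eqF//; lra.
Qed.

Lemma normLpI_ge0 (R : realType) (p : R) (F : R -> R) : (0 <= normLpI p F)%E.
Proof. exact: Lnorm_ge0. Qed.

Lemma normLpI_le (R : realType) (p c : R) (F : R -> R) : 1 <= p -> 0 <= c ->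
  (\int[mu]_(x in Ipi) (`|F x| `^ p)%:E <= (c `^ p)%:E)%E ->
  (normLpI p F <= c%:E)%E.
Proof.
move=> p1 c0; rewrite -normLpI_powR// => h.
have p0 : p != 0 by rewrite gt_eqF//; lra.
have pV0 : 0 <= p^-1 by rewrite invr_ge0; lra.
rewrite -(poweRe1 (normLpI_ge0 _ _ _)) -(mulfV p0) poweRrM.
have -> : c = (c `^ p) `^ p^-1 by rewrite -powRrM mulfV// powRr1.
rewrite -poweR_EFin; apply: gt0_ler_poweR => //.
- by rewrite in_itv/= poweR_ge0 leey.
- by rewrite in_itv/= lee_fin powR_ge0 leey.
Qed.

Lemma normLpI_integrable (R : realType) (p : R) (F : measurableTypeR R -> R) :
  1 <= p -> measurable_fun (Ipi : set (measurableTypeR R)) F ->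
  (normLpI p F < +oo)%E ->
  mu.-integrable Ipi (EFin \o (fun x => `|F x| `^ p)).
Proof.
move=> p1 mF Foo; apply/integrableP; split.
  by apply/measurable_EFinP; exact: measurable_norm_powR.
have := poweR_lty p Foo; rewrite normLpI_powR//; apply: le_lt_trans.
rewrite le_eqVlt; apply/orP; left; apply/eqP; apply: eq_integral => x _.
by rewrite /= ger0_norm// powR_ge0.
Qed.

Lemma m_rate_gt0 (R : realType) (p : R) (n : nat) : (0 < n)%N -> 0 < m_rate p n.
Proof.
move=> n0; rewrite /m_rate; have nR : 0 < n%:R :> R by rewrite ltr0n.
case: ifP => _.
  by rewrite divr_gt0// ltr_pwDl// ln_ge0// ler1n.
by rewrite addr_gt0// invr_gt0// powR_gt0.
Qed.

(* For [p = 1] the quotient [p / (p - 1)] is [1 / 0 = 0]. *)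
Lemma log_rate_le_m_rate (R : realType) (p : R) (n : nat) : 1 <= p -> (0 < n)%N ->
  (1 + ln n%:R) / n%:R <= (1 + p / (p - 1)) * m_rate p n.
Proof.
move=> p1 n0; have nR : 0 < n%:R :> R by rewrite ltr0n.
rewrite /m_rate; case: eqP => [->|/eqP pN1].
  by rewrite subrr invr0 mulr0 addr0 mul1r.
have {pN1}p1 : 1 < p by rewrite lt_neqAle eq_sym pN1.
have p10 : 0 < p - 1 by lra.
have p0 : 0 < p by lra.
have c0 : 0 < p / (p - 1) by exact: divr_gt0.
set a := 1 - p^-1.
have ea : (p / (p - 1)) * a = 1 by rewrite /a; field; rewrite !gt_eqF.
(* With a = 1 - 1/p, ln n = ln(n^a)/a <= n^a/a, where 1/a = p/(p - 1). *)
have lna : ln n%:R <= (p / (p - 1)) * (n%:R / n%:R `^ p^-1).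
  have -> : n%:R / n%:R `^ p^-1 = n%:R `^ a :> R.
    by rewrite /a powRB ?powRr1 ?(ltW nR)//; apply/implyP => _; rewrite gt_eqF.
  have := ltW (ln_sublinear (powR_gt0 a nR)); rewrite ln_powR => l.
  have := ler_wpM2l (ltW c0) l; rewrite mulrA ea mul1r; exact.
set q := n%:R `^ p^-1 in lna *; have q0 : 0 < q by exact: powR_gt0.
have l2 : ln n%:R / n%:R <= p / (p - 1) * q^-1.
  by rewrite ler_pdivrMr// (le_trans lna)// le_eqVlt; apply/orP; left; apply/eqP; ring.
have n1 : 0 < n%:R^-1 :> R by rewrite invr_gt0.
have q1 : 0 < q^-1 by rewrite invr_gt0.
rewrite mulrDl mul1r mulrDl mulrDr.
have := mulr_gt0 c0 n1; lra.
Qed.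

Theorem theorem3p7 (R : realType) (p : R) (hp : 1 <= p) :
  exists Rp Rtp : R, 0 < Rp /\ 0 < Rtp /\
    forall (f : R -> R) (n : nat), in_LpI p f -> (0 < n)%N ->
      (normLpI p (GK n f \- f)%R <= Rp%:E * Kfunctional p f (Rtp * m_rate p n)%R)%E.
Proof.
have p0 : 0 < p by lra.
(* In [integral_GK_sub_le] both p-th powers will be bounded by that of the K-functional term, so
   their coefficients 97^p 192 + 1 and 4 add up. *)
pose K : R := 3 `^ p * (97 `^ p * 192 + 5).
have K0 : 0 < K.
  by rewrite mulr_gt0 ?powR_gt0// ltr_wpDl// mulr_ge0// powR_ge0.
pose Rp := K `^ p^-1.
have Rp0 : 0 < Rp by exact: powR_gt0.
have RpE : Rp `^ p = K by rewrite /Rp -powRrM mulVf ?gt_eqF// powRr1// ltW.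
pose c := 1 + p / (p - 1).
have c0 : 0 < c by rewrite ltr_pwDl// divr_ge0//; lra.
exists Rp, (192 * c); split=> //; split; first by rewrite mulr_gt0.
move=> f n fLp n0; set d := 192 * c * m_rate p n.
have d0 : 0 < d by rewrite !mulr_gt0// m_rate_gt0.
(* Moving the positive constant to the left reduces the bound by an infimum to a bound for each
   g. *)
rewrite -lee_pdivrMl//; apply: le_ereal_inf_tmp => _ [g Cg <-].
rewrite lee_pdivrMl//.
have N0 := normLpI_ge0 R p (f \- g).
have S0 : (0 <= sup_normI (deriveI g))%E.
  apply: le_ereal_sup_tmp; exists `|deriveI g 0|%:E; last by rewrite lee_fin.
  by exists 0 => //; rewrite /Ipi/= in_itv/= lexx pi_ge0.
have mI := @measurable_Ipi R.
have [mfT fN] : measurable_fun setT (f \_ Ipi : measurableTypeR R -> R) /\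
    (normLpI p f < +oo)%E.
  by move: fLp; rewrite /in_LpI inE => /andP[]; rewrite !inE/=.
have mf : measurable_fun (Ipi : set (measurableTypeR R)) f.
  by apply/measurable_restrictT.
have mg : measurable_fun (Ipi : set (measurableTypeR R)) g.
  by apply: subspace_continuous_measurable_fun => //;
    exact: derivableI_continuous Cg.1.
have mfg : measurable_fun (Ipi : set (measurableTypeR R)) (f \- g).
  exact: measurable_funB.
have jf := powR_integrable R p 0 pi f hp mf (normLpI_integrable R p f hp mf fN).
(* If either nonnegative term is infinite, the right side is +oo; afterwards both are real
   numbers. *)
have [->|SN] := eqVneq (sup_normI (deriveI g)) +oo%E.
  rewrite gt0_muley ?lte_fin// addey ?gt0_muley ?lte_fin ?leey//.
  by rewrite -ltNye (lt_le_trans _ N0).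
have [->|NN] := eqVneq (normLpI p (f \- g)) +oo%E.
  rewrite addye ?gt0_muley ?lte_fin ?leey//.
  by rewrite -ltNye (lt_le_trans _ (mule_ge0 _ S0))// lee_fin ltW.
have Nfin : normLpI p (f \- g) \is a fin_num by rewrite ge0_fin_numE// ltey.
have Sfin : sup_normI (deriveI g) \is a fin_num by rewrite ge0_fin_numE// ltey.
have Noo : (normLpI p (f \- g)%R < +oo)%E by rewrite ltey.
have ju := normLpI_integrable R p (fun x => f x - g x) hp mfg Noo.
have jg : mu.-integrable Ipi (EFin \o g).
  apply: continuous_compact_integrable; first exact: segment_compact.
  exact: derivableI_continuous Cg.1.
rewrite -(fineK Nfin) -(fineK Sfin).
set N := fine (normLpI p (f \- g)); set L := fine (sup_normI (deriveI g)).
have NR0 : 0 <= N by exact: fine_ge0.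
have L0 : 0 <= L by exact: fine_ge0.
have bL (x : R) : Ipi x -> `|deriveI g x| <= L.
  by move=> Ix; rewrite -lee_fin /L fineK//; apply: ereal_sup_ubound; exists x.
have dL0 : 0 <= d * L by exact: mulr_ge0 (ltW d0) L0.
have NdL0 := addr_ge0 NR0 dL0.
have := integral_GK_sub_le R p n f g L hp n0 jf jg ju (C1I_lipschitz R g L Cg bL) L0.
have -> : \int[mu]_(x in Ipi) (`|f x - g x| `^ p) = N `^ p.
  by rewrite /Rintegral -normLpI_powR// -(fineK Nfin).
move=> h; rewrite -!EFinM; apply: normLpI_le => //.
  exact: mulr_ge0 (ltW Rp0) NdL0.
apply: le_trans h _; rewrite lee_fin (powRM _ (ltW Rp0) NdL0).
rewrite RpE /K -[leRHS]mulrA; apply: ler_wpM2l; first exact: powR_ge0.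
have lnn : 0 <= (1 + ln n%:R) / n%:R :> R.
  by rewrite divr_ge0// addr_ge0// ln_ge0// ler1n.
(* The factor 192c in [d] was chosen so that the left side is already at most dL. *)
have ZdL : 192 * L * ((1 + ln n%:R) / n%:R) <= N + d * L.
  have := ler_wpM2l L0 (log_rate_le_m_rate R p n hp n0).
  rewrite -/c /d; lra.
have Z0 : 0 <= 192 * L * ((1 + ln n%:R) / n%:R).
  by apply: mulr_ge0 lnn; exact: mulr_ge0.
have T1 : (192 * L * ((1 + ln n%:R) / n%:R)) `^ p <= (N + d * L) `^ p.
  by apply: ge0_ler_powR; rewrite ?nnegrE//; lra.
have T2 : N `^ p <= (N + d * L) `^ p.
  by apply: ge0_ler_powR; rewrite ?nnegrE//; lra.
have q0 : 0 <= 97 `^ p * 192 + 1 by rewrite addr_ge0// mulr_ge0// powR_ge0.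
have := ler_wpM2l q0 T2; lra.
Qed.
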